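(* Let $X$ be an infinite-dimensional Banach space such that $Sz(X)<\omega_1$ (in particular, $Sz(X)$ is defined) and let $\delta>0$. Then there exists a closed linear subspace $Y\subseteq X$ such that $Y$ has a shrinking (Schauder) basis with basis constant not exceeding $1+\delta$ and such that $$\forall\,\epsilon>0\quad Sz\Big(Y,\frac{\epsilon}{66}\Big)\geq Sz(X,\epsilon),$$ hence $Sz(Y)=Sz(X)$.
   Context: Banach spaces are over the scalar field $\mathbb{R}$ or $\mathbb{C}$; $B_{X^*}$ is the closed unit ball of the dual $X^*$; $\omega_1$ is the first uncountable ordinal. Szlenk index. For $\epsilon>0$ and a weak$^*$-compact set $K\subseteq X^*$ let $$s_\epsilon(K)=\{x^*\in K : \operatorname{diam}(U\cap K)>\epsilon \text{ for every weak}^*\text{-open } U\ni x^*\}$$ (diameter with respect to the norm). Iterate transfinitely: $s_\epsilon^0(K)=K$, $s_\epsilon^{\xi+1}(K)=s_\epsilon(s_\epsilon^\xi(K))$, and $s_\epsilon^\xi(K)=\bigcap_{\zeta<\xi}s_\epsilon^\zeta(K)$ for $\xi$ a limit ordinal. The $\epsilon$-Szlenk index $Sz(K,\epsilon)$ is the least ordinal $\xi$ with $s_\epsilon^\xi(K)=\emptyset$, if such an ordinal exists; otherwise it is undefined. If $Sz(K,\epsilon)$ is defined for all $\epsilon>0$, then $Sz(K)=\sup_{\epsilon>0}Sz(K,\epsilon)$; otherwise $Sz(K)$ is undefined. For a Banach space $X$ put $Sz(X,\epsilon)=Sz(B_{X^*},\epsilon)$ and $Sz(X)=Sz(B_{X^*})$.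 *)

(* Defs.v *)
From HB Require Import structures.
From mathcomp Require Import all_boot all_order all_algebra.
From mathcomp Require Import generic_quotient.
From mathcomp Require Import complex.
From mathcomp Require Import all_classical all_reals all_analysis.

Set Implicit Arguments.
Unset Strict Implicit.
Unset Printing Implicit Defensive.

Import Order.TTheory GRing.Theory Num.Theory.
Import numFieldNormedType.Exports.

Local Open Scope classical_set_scope.
Local Open Scope quotient_scope.
Local Open Scope ring_scope.

(* ------------------------------------------------------------------------ *)
(* Ordinals: well-founded trees, with the tree [tsup f] standing for the    *)
(* supremum of the ordinals [f i], modulo mutual comparison.                *)

Inductive otree : Type :=
| tzero : otree
| tsucc : otree -> otree
| tsup (I : Type) (f : I -> otree) : otree.

Fixpoint tle (a b : otree) {struct a} : Prop :=
  match a with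
  | tzero => True
  | tsucc a' =>
      (fix tlt (b : otree) : Prop :=
         match b with
         | tzero => False
         | tsucc b' => tle a' b'
         | tsup _ f => exists i, tlt (f i)
         end) b
  | tsup _ f => forall i, tle (f i) b
  end.

Definition tlt (a b : otree) : Prop := tle (tsucc a) b.

Lemma tle_sup a (I : Type) (f : I -> otree) i : tle a (f i) -> tle a (tsup f).
Proof. by elim: a => [//|a IH|J g IH] /= h; [exists i|move=> j; exact: IH]. Qed.

Lemma tle_refl a : tle a a.
Proof. by elim: a => [//|//|I f IH] i; apply: (@tle_sup _ _ _ i). Qed.

Lemma tle_trans b a c : tle a b -> tle b c -> tle a c.
Proof.
elim: b a c => [|b IHb|I g IHg] a c.
- by elim: a => [//|//|J f IH] /= h _ j; exact: IH.
- elim: a => [//|a _|J f IHa]; last by move=> /= h bc j; exact: IHa.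
  elim: c => [//|c IHc|J h IHc]; first by move=> ab bc; exact: IHb bc.
  by move=> ab [j bj]; exists j; exact: IHc.
- elim: a => [//|a IHa|J f IHa]; last by move=> /= h bc j; exact: IHa.
  by move=> [i ai] /(_ i); exact: (IHg i (tsucc a)) ai.
Qed.

Lemma tle_succ a : tle a (tsucc a).
Proof.
elim: a => [//|a IH //|I f IH] i; apply: tle_trans (IH i) _.
exact: (@tle_sup _ _ f i (tle_refl _)).
Qed.

Lemma tltW a b : tlt a b -> tle a b.
Proof. exact/tle_trans/tle_succ. Qed.

Lemma tle_lt_trans b a c : tle a b -> tlt b c -> tlt a c.
Proof. by move=> ab; apply: (@tle_trans (tsucc b) (tsucc a)). Qed.

Lemma tlt_le_trans b a c : tlt a b -> tle b c -> tlt a c.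
Proof. exact: tle_trans. Qed.

Lemma tlt_irr a : ~ tlt a a.
Proof.
elim: a => [//|a IH //|I f IH] [i fi]; apply: (IH i).
exact: tle_lt_trans (@tle_sup _ _ f i (tle_refl _)) fi.
Qed.

Lemma tle_or_gt a b : tle a b \/ tlt b a.
Proof.
elim: a b => [|a IHa|I f IHf] b; first by left.
- elim: b => [|b IHb|J g IHg]; [by right|exact: IHa|].
  have [[j aj]|h] := pselect (exists j, tlt a (g j)); first by left; exists j.
  right=> j; have [aj|//] := IHg j.
  by exfalso; apply: h; exists j.
- have [[i bi]|h] := pselect (exists i, tlt b (f i)); first by right; exists i.
  left=> i; have [//|bi] := IHf i b.
  by exfalso; apply: h; exists i.
Qed.

Lemma tlt_wf : well_founded tlt.
Proof.
suff h a : forall b, tle b a -> Acc tlt b.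
  by move=> a; apply: (h a); exact: tle_refl.
elim: a => [|a IH|I f IH] b ba; constructor=> c cb;
  move: (tlt_le_trans cb ba) => {cb ba}.
- by [].
- exact: IH.
- by case=> i /tltW; exact: IH.
Qed.

HB.instance Definition _ := gen_eqMixin otree.
HB.instance Definition _ := gen_choiceMixin otree.

Definition teqv (a b : otree) : bool := `[< tle a b /\ tle b a >].

Lemma teqv_refl : reflexive teqv.
Proof. by move=> a; apply/asboolP; split; exact: tle_refl. Qed.

Lemma teqv_sym : symmetric teqv.
Proof. by move=> a b; apply/asboolP/asboolP => -[]. Qed.

Lemma teqv_trans : transitive teqv.
Proof.
move=> b a c /asboolP[ab ba] /asboolP[bc cb]; apply/asboolP.
by split; [exact: tle_trans bc|exact: tle_trans ba].
Qed.

Canonical teqv_equiv := EquivRel teqv teqv_refl teqv_sym teqv_trans.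

Definition ord : Type := {eq_quot teqv_equiv}.
HB.instance Definition _ := Choice.on ord.

Definition oclass (t : otree) : ord := \pi_({eq_quot teqv_equiv}) t.
Definition otree_of (a : ord) : otree := repr (a : {eq_quot teqv_equiv}).

Lemma otree_ofK : cancel otree_of oclass.
Proof. by move=> a; exact: reprK. Qed.

Lemma oclassK t : tle (otree_of (oclass t)) t /\ tle t (otree_of (oclass t)).
Proof.
have : oclass (otree_of (oclass t)) = oclass t by rewrite otree_ofK.
by move/eqmodP/asboolP.
Qed.

Definition ole (a b : ord) : bool := `[< tle (otree_of a) (otree_of b) >].
Lemma ole_anti : antisymmetric ole.
Proof.
move=> a b /andP[/asboolP ab /asboolP ba].
rewrite -(otree_ofK a) -(otree_ofK b).
by apply/eqmodP/asboolP.
Qed.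

Lemma ole_trans : transitive ole.
Proof.
by move=> b a c /asboolP ab /asboolP bc; apply/asboolP; exact: tle_trans bc.
Qed.

Lemma ole_total : total ole.
Proof.
move=> a b; apply/orP.
have [h|/tltW h] := tle_or_gt (otree_of a) (otree_of b);
  by [left; apply/asboolP|right; apply/asboolP].
Qed.

Fact ord_display : Order.disp_t. Proof. exact: Order.Disp tt tt. Qed.

Lemma ole_refl : reflexive ole.
Proof. by move=> a; apply/asboolP; exact: tle_refl. Qed.

HB.instance Definition _ :=
  Order.Le_isPOrder.Build ord_display ord ole_refl ole_anti ole_trans.
HB.instance Definition _ :=
  Order.POrder_isTotal.Build ord_display ord ole_total.

Lemma oleP (a b : ord) : reflect (tle (otree_of a) (otree_of b)) (a <= b)%O.
Proof. exact: asboolP. Qed.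

Lemma oltP (a b : ord) : reflect (tlt (otree_of a) (otree_of b)) (a < b)%O.
Proof.
rewrite ltNge; apply: (iffP negP) => [h|ab /oleP ba].
  by have [ba|//] := tle_or_gt (otree_of b) (otree_of a); case: h; apply/oleP.
exact: (tlt_irr (tlt_le_trans ab ba)).
Qed.

Lemma ole_class a t : (a <= oclass t)%O <-> tle (otree_of a) t.
Proof.
have [h1 h2] := oclassK t.
by split=> [/oleP h|h]; [|apply/oleP]; exact: tle_trans h _.
Qed.

Lemma olt_class a t : (a < oclass t)%O <-> tlt (otree_of a) t.
Proof.
have [h1 h2] := oclassK t.
by split=> [/oltP h|h]; [|apply/oltP]; exact: tlt_le_trans h _.
Qed.

Lemma class_ole a t : (oclass t <= a)%O <-> tle t (otree_of a).
Proof.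
have [h1 h2] := oclassK t.
split=> [/oleP h|h]; [|apply/oleP]; by [exact: tle_trans h|exact: tle_trans h].
Qed.

Lemma olt_wf : well_founded (fun a b : ord => (a < b)%O).
Proof.
move=> a; move: {2}(otree_of a) (erefl (otree_of a)) => t.
elim/(well_founded_ind tlt_wf): t a => t IH a at_; constructor=> b /oltP.
by rewrite at_ => bt; exact: IH bt _ erefl.
Qed.

Definition ozero : ord := oclass tzero.
Definition osucc (a : ord) : ord := oclass (tsucc (otree_of a)).

Lemma ozero_le a : (ozero <= a)%O.
Proof. exact/class_ole. Qed.

Lemma osucc_le a b : (osucc a <= b)%O = (a < b)%O.
Proof. by apply/idP/oltP => /class_ole. Qed.

Definition olimit (a : ord) : Prop :=
  (ozero < a)%O /\ forall b, (b < a)%O -> (osucc b < a)%O.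

(* The trees built from zero by successors and countable suprema; the       *)
(* supremum of their classes is the first uncountable ordinal.              *)
Inductive ctree : Type :=
| czero : ctree
| csucc : ctree -> ctree
| csup : (nat -> ctree) -> ctree.

Fixpoint otree_of_ctree (c : ctree) : otree :=
  match c with
  | czero => tzero
  | csucc c' => tsucc (otree_of_ctree c')
  | csup f => tsup (fun n => otree_of_ctree (f n))
  end.

Definition omega1 : ord := oclass (tsup otree_of_ctree).

Lemma lt_omega1 (a : ord) : (a < omega1)%O <-> countable [set b | (b < a)%O].
Proof.
split.
- move=> /olt_class[c ac].
  suff : countable [set b | (b < oclass (otree_of_ctree c))%O].
    apply/sub_countable/subset_card_le => b /= ba.
    by apply/olt_class; apply: (tlt_le_trans _ (tltW ac)); exact/oltP.
  elim: c {ac} => [|c IHc|f IHf] /=.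
  + rewrite (_ : [set _ | _] = set0)// -subset0 => b /= /olt_class.
    by rewrite /tlt.
  + have : countable ([set b | (b < oclass (otree_of_ctree c))%O] `|`
                      [set oclass (otree_of_ctree c)]).
      rewrite -bigcup2E; apply: bigcup_countable => // -[|[|n]] _ //=.
    apply/sub_countable/subset_card_le => b /= /olt_class h.
    have : (b <= oclass (otree_of_ctree c))%O by exact/ole_class.
    by rewrite le_eqVlt => /predU1P[->|bc]; [right|left].
  + have : countable (\bigcup_n
        [set b | (b < oclass (otree_of_ctree (f n)))%O]).
      by apply: bigcup_countable => // n _; exact: IHf.
    apply/sub_countable/subset_card_le => b /= /olt_class[n h].
    by exists n => //; exact/olt_class.
- elim/(well_founded_ind olt_wf): a => a IH ca.
  have /countable_injP[g ginj] := ca.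
  have /choice[h hP] b : exists c : ctree,
      (b < a)%O -> (b < oclass (otree_of_ctree c))%O.
    have [ba|_] := boolP (b < a)%O; last by exists czero.
    have : (b < omega1)%O.
      apply: IH => //; apply: sub_countable ca; apply: subset_card_le.
      by move=> d /= db; exact: lt_trans ba.
    by move=> /olt_class[c bc]; exists c => _; exact/olt_class.
  have /choice[k kP] n : exists c : ctree, forall b, (b < a)%O -> g b = n ->
      (b < oclass (otree_of_ctree c))%O.
    have [[b [ba bn]]|hn] := pselect (exists b, (b < a)%O /\ g b = n).
      exists (h b) => d da dn; suff -> : d = b by exact: hP.
      by apply: ginj; rewrite ?inE// dn.
    by exists czero => b ba bn; exfalso; apply: hn; exists b.
  apply/olt_class; exists (csucc (csup k)) => /=; apply/ole_class.
  rewrite leNgt; apply/negP => ka.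
  have /olt_class : (oclass (otree_of_ctree (csup k)) <
                     oclass (otree_of_ctree (k (g (oclass
                       (otree_of_ctree (csup k)))))))%O by exact: kP.
  move=> h1; have [_ h2] := oclassK (otree_of_ctree (csup k)).
  apply: (@tlt_irr (otree_of_ctree (csup k))).
  by apply: (tle_lt_trans h2 _); apply: (tlt_le_trans h1 _);
     exact: (tle_sup (tle_refl _)).
Qed.

(* ------------------------------------------------------------------------ *)

(* [scalar_field R K] says that K is the field of real or complex numbers.  *)
(* In both cases the norm of a normed space over K takes its values in K,   *)
(* and the order of K forces any eps with 0 < eps to be a real number.      *)
Inductive scalar_field (R : realType) : numFieldType -> Prop :=
| real_scalars : scalar_field R R
| complex_scalars : scalar_field R R[i].

Definition infinite_dimensional (K : numFieldType) (X : lmodType K) : Prop :=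
  ~ exists (n : nat) (v : 'I_n -> X), forall x : X,
      exists c : 'I_n -> K, x = \sum_(i < n) c i *: v i.

Section dual_space.
Context {K : numFieldType} {X : normedModType K}.

Definition dual : set (X -> K) :=
  [set f : X -> K | scalar f /\ continuous f].

(* The supremum exists whenever f is in the dual and K is R or C. *)
Definition dual_norm (f : X -> K) : K :=
  supremum 0 [set `|f x| | x in [set x : X | `|x| <= 1]].

Definition dual_ball : set (X -> K) :=
  [set f | dual f /\ dual_norm f <= 1].

Definition weak_star_open (U : set (X -> K)) : Prop :=
  exists2 V : set {ptws X -> K}, open V & U = V `&` dual.

(* diam A > eps: eps is exceeded by the supremum of the distances, that is, *)
(* by one of them. *)
Definition diam_gt (A : set (X -> K)) (eps : K) : Prop :=
  exists f g, [/\ A f, A g & eps < dual_norm (f \- g)].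

Definition szlenk_derivative (eps : K) (C : set (X -> K)) : set (X -> K) :=
  [set f | C f /\
    forall U, weak_star_open U -> U f -> diam_gt (U `&` C) eps].

Fixpoint tree_derivative (eps : K) (C : set (X -> K)) (t : otree) :
    set (X -> K) :=
  match t with
  | tzero => C
  | tsucc t' => szlenk_derivative eps (tree_derivative eps C t')
  | tsup _ f => C `&` \bigcap_i tree_derivative eps C (f i)
  end.

(* The iterates are determined by [szlenk_iter0], [szlenk_iterS] and        *)
(* [szlenk_iter_lim] below. *)
Definition szlenk_iter (eps : K) (C : set (X -> K)) (xi : ord) :
  set (X -> K) := tree_derivative eps C (otree_of xi).

Lemma szlenk_derivative_sub eps C : szlenk_derivative eps C `<=` C.
Proof. by move=> f []. Qed.

Lemma szlenk_derivative_mono eps C D :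
  C `<=` D -> szlenk_derivative eps C `<=` szlenk_derivative eps D.
Proof.
move=> CD f [Cf h]; split=> [|U oU Uf]; first exact: CD.
have [g [k [[Ug Cg] [Uk Ck] d]]] := h U oU Uf.
by exists g, k; split => //; split => //; exact: CD.
Qed.

Lemma tree_derivative_sub eps C t : tree_derivative eps C t `<=` C.
Proof.
elim: t => [//|t IH|I f _]; last by move=> ? [].
exact: subset_trans (@szlenk_derivative_sub _ _) IH.
Qed.

Lemma tree_derivative_anti eps C s t : tle s t ->
  tree_derivative eps C t `<=` tree_derivative eps C s.
Proof.
elim: s t => [|s IHs|I f IHf] t.
- by move=> _; exact: tree_derivative_sub.
- elim: t => [//|t IHt|J g IHg].
    by move=> st; apply: szlenk_derivative_mono; exact: IHs.
  by move=> [j sj] x [_ /(_ j Logic.I)]; exact: IHg.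
- move=> ft x xt; split; first exact: tree_derivative_sub xt.
  by move=> i _; exact: IHf (ft i) _ xt.
Qed.

Lemma szlenk_iter_anti eps C (xi zeta : ord) : (xi <= zeta)%O ->
  szlenk_iter eps C zeta `<=` szlenk_iter eps C xi.
Proof. by move/oleP; exact: tree_derivative_anti. Qed.

Lemma szlenk_iter_class eps C t :
  szlenk_iter eps C (oclass t) = tree_derivative eps C t.
Proof.
by have [h1 h2] := oclassK t; rewrite eqEsubset; split;
  exact: tree_derivative_anti.
Qed.

Lemma szlenk_iter0 eps C : szlenk_iter eps C ozero = C.
Proof. exact: szlenk_iter_class. Qed.

Lemma szlenk_iterS eps C xi : szlenk_iter eps C (osucc xi) =
  szlenk_derivative eps (szlenk_iter eps C xi).
Proof. exact: szlenk_iter_class. Qed.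

Lemma szlenk_iter_lim eps C xi : olimit xi -> szlenk_iter eps C xi =
  \bigcap_(zeta in [set z | (z < xi)%O]) szlenk_iter eps C zeta.
Proof.
move=> [xi0 xiS]; rewrite eqEsubset; split=> [f fxi zeta /= /ltW|f h].
  by move/szlenk_iter_anti; exact.
rewrite -[xi]otree_ofK in xi0 xiS h *.
rewrite szlenk_iter_class; elim: (otree_of xi) xi0 xiS h => [|t _|I g IH].
- by rewrite ltxx.
- move=> _ tS _; suff : (oclass (tsucc t) < oclass (tsucc t))%O by rewrite ltxx.
  apply: le_lt_trans (tS (oclass t) _).
    apply/class_ole; have [_] := oclassK (tsucc (otree_of (oclass t))).
    by apply: tle_trans; have [_] := oclassK t.
  by apply/olt_class; have [] := oclassK t.
- move=> g0 gS h; split.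
    by rewrite -(szlenk_iter0 eps C); exact: h.
  move=> i _; have le_i : (oclass (g i) <= oclass (tsup g))%O.
    apply/class_ole; have [_] := oclassK (tsup g).
    exact/tle_trans/(tle_sup (tle_refl _)).
  have [lt_i|ge_i] := ltP (oclass (g i)) (oclass (tsup g)).
    by rewrite -szlenk_iter_class; exact: h.
  have E : oclass (g i) = oclass (tsup g) by apply/eqP; rewrite eq_le le_i.
  by apply: IH; rewrite E.
Qed.

(* "Sz(C, eps) is defined and equal to xi" *)
Definition szlenk_eps (C : set (X -> K)) (eps : K) (xi : ord) : Prop :=
  szlenk_iter eps C xi = set0 /\
  forall zeta, szlenk_iter eps C zeta = set0 -> (xi <= zeta)%O.

(* "Sz(C) is defined and equal to xi" *)
Definition szlenk (C : set (X -> K)) (xi : ord) : Prop :=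
  (forall eps, 0 < eps -> exists zeta, szlenk_eps C eps zeta) /\
  isLub [set zeta | exists2 eps, 0 < eps & szlenk_eps C eps zeta] xi.

End dual_space.

Definition szlenk_eps_index (K : numFieldType) (X : normedModType K)
  (eps : K) (xi : ord) : Prop := szlenk_eps (@dual_ball K X) eps xi.

Definition szlenk_index (K : numFieldType) (X : normedModType K)
  (xi : ord) : Prop := szlenk (@dual_ball K X) xi.

Section schauder_basis.
Context {K : numFieldType} {X : normedModType K}.

Definition expansion (e : nat -> X) (x : X) (a : nat -> K) : Prop :=
  series (fun i => a i *: e i) @ \oo --> x.

Definition schauder_basis (e : nat -> X) : Prop :=
  forall x, exists! a, expansion e x a.

Definition coordinate (e : nat -> X) (i : nat) (x : X) : K :=
  get [set a | expansion e x a] i.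

Definition partial_sum (e : nat -> X) (n : nat) (x : X) : X :=
  \sum_(0 <= i < n) coordinate e i x *: e i.

(* b = sup_n ||P_n||, where P_n is the n-th partial sum projection. *)
Definition basis_constant (e : nat -> X) (b : K) : Prop :=
  isLub [set r | exists n, exists2 x : X, `|x| <= 1 & r = `|partial_sum e n x|]
        b.

(* The coordinate functionals form a Schauder basis of the dual space. *)
Definition shrinking (e : nat -> X) : Prop :=
  (forall i, dual (coordinate e i)) /\
  forall f, dual f -> exists! a : nat -> K,
    dual_norm (fun x => f x - \sum_(0 <= i < n) a i * coordinate e i x)
      @[n --> \oo] --> (0 : K).

End schauder_basis.

(* ------------------------------------------------------------------------ *)

Section subspace.
Context {K : numFieldType} {X : normedModType K} (Y : submodClosed X).

Definition subspace_type : Type := {x : X | x \in Y}.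

HB.instance Definition _ := SubType.on subspace_type.
HB.instance Definition _ := [Choice of subspace_type by <:].
HB.instance Definition _ := [SubChoice_isSubLmodule of subspace_type by <:].

Definition subspace_norm (y : subspace_type) : K := `|\val y|.

Lemma ler_subspace_normD x y :
  subspace_norm (x + y) <= subspace_norm x + subspace_norm y.
Proof. by rewrite /subspace_norm raddfD; exact: ler_normD. Qed.

Lemma subspace_normZ (a : K) x : subspace_norm (a *: x) = `|a| * subspace_norm x.
Proof. by rewrite /subspace_norm linearZ /= normrZ. Qed.

Lemma subspace_norm0_eq0 x : subspace_norm x = 0 -> x = 0.
Proof. by move=> /normr0_eq0 x0; apply: val_inj; rewrite x0 raddf0. Qed.

HB.instance Definition _ := Lmodule_isNormed.Build K subspace_type
  ler_subspace_normD subspace_normZ subspace_norm0_eq0.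

End subspace.

(* Main.v *)
Require Import Defs.
From HB Require Import structures.
From mathcomp Require Import all_boot all_order all_algebra.
From mathcomp Require Import complex ring lra.
From mathcomp Require Import all_classical all_reals all_analysis.

Set Implicit Arguments.
Unset Strict Implicit.
Unset Printing Implicit Defensive.

Import Order.TTheory GRing.Theory Num.Theory.
Import numFieldNormedType.Exports.

Local Open Scope classical_set_scope.
Local Open Scope ring_scope.

(** Write L(eps, xi) for the xi-th eps-derivative of the dual ball of X.  The
    subspace Y is the closed span of a sequence y_0, y_1, ... chosen one vector
    at a time.  At stage n a finite list G_n of functionals on X is fixed and
    from then on every vector, y_n included, is taken in the common kernel of
    G_n.  What is put into these lists gives Y its properties.

    Basis constant.  G_n contains functionals that almost norm the span of
    y_0, ..., y_(n-1), so adding to a vector of this span anything killed by G_n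
    decreases the norm by a factor at most 1 + delta ([mazur_annihilator]).
    All later vectors are killed by G_n, so this one inequality bounds the n-th
    partial sum projection and no infinite product of constants appears.  The
    coordinate functionals of the y_j chosen before are kept in the kernel
    condition as well, which makes the sequence biorthogonal with coordinate
    functionals defined on all of X.

    Lower estimate.  Since alpha is countable, a countable set of data (eps,
    xi, B) matters, where eps runs through a countable dense set, xi < alpha,
    and B is a weak-star open box given by finitely many of the y_j and by
    centres and a tolerance from a countable set.  Each is treated at some
    stage.  If the eps-derivative of L(eps, xi) meets B, then B contains two
    points of L(eps, xi) at distance more than eps; passing to a subspace of
    finite codimension costs only a constant factor, because the unit ball is,
    up to small errors, a finite set plus a multiple of the unit ball of that
    subspace.  So y_n can be chosen in the common kernel and such that two
    points of L(eps, xi) in B differ at y_n by more than eps / 6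
    ([szlenk_derivative_annihilator]).  By induction on xi the restrictions to
    Y of the elements of L(eps, xi) lie in the xi-th (eps / 6)-derivative of
    the dual ball of Y ([level_restriction]).  The factor 66 = 6 * 11 leaves
    room for replacing eps by an element of the dense set in [eps / 11, eps].

    Upper estimate and shrinking basis.  Both rest on one compactness lemma
    ([closure_restriction_lift]): if phi is a weak-star limit of restrictions
    of elements of C, all at distance more than eps from phi, then phi is the
    restriction of an element of the eps-derivative of C.  Hence the xi-th
    2 eps-derivative of the dual ball of Y consists of restrictions of elements
    of L(eps, xi) ([szlenk_iter_restriction]), and Sz(Y) <= Sz(X).  Next let phi
    be in the dual ball of Y.  Its extensions in the dual ball of X form a
    weak-star compact set, so there is a last xi for which they meet
    L(eps, xi) ([szlenk_last_level]).  For this xi the lemma says that the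
    elements of L(eps, xi) whose restrictions are weak-star close enough to phi
    are within eps of phi in norm on Y.  At some stage one of them was put into
    G_n; it vanishes on y_n, y_(n+1), ..., so on Y it is a combination of
    coordinate functionals.  These therefore span a norm dense subspace of the
    dual of Y ([finite_coordinates_dense]), which for a Schauder basis means
    that it is shrinking. *)

(** * The Hahn-Banach theorem for real sublinear functionals *)

(** Partial linear functionals are handled as linear subspaces of V * K, so that
    the union of a chain of extensions is again an extension. *)
Definition linear_graph {K : numFieldType} {V : lmodType K} (G : set (V * K)) :=
  forall t p q, G p -> G q -> G (t *: p.1 + q.1, t * p.2 + q.2).

Section real_hahn_banach.
Context {R : realType} {V : lmodType R} (p : V -> R).
Hypothesis pD : forall x y, p (x + y) <= p x + p y.
Hypothesis pZ : forall t x, 0 <= t -> p (t *: x) = t * p x.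

Let dominated (G : set (V * R)) := forall q, G q -> q.2 <= p q.1.

(** Two values a <= b at x put (0, b - a) in the graph, and then b - a <= p 0 = 0. *)
Lemma dominated_graph_fun G x a b :
  linear_graph G -> dominated G -> G (x, a) -> G (x, b) -> a = b.
Proof.
move=> lG dG.
wlog ab : a b / a <= b.
  by move=> h Ga Gb; have [/h|/ltW/h] := leP a b; [|move=> /(_ Gb Ga)]; auto.
move=> Ga Gb; apply/eqP; rewrite eq_le ab -subr_ge0 /= -oppr_le0 opprB.
have := lG (-1) _ _ Ga Gb; move/dG => /=; rewrite scaleN1r mulN1r addNr.
by rewrite -(scale0r 0) pZ// mul0r addrC.
Qed.

(** The value c at z has to satisfy a - p (x - z) <= c <= p (x + z) - a for all
    (x, a) in the graph; subadditivity of p shows that the supremum of the lower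
    bounds is admissible. *)
Lemma dominated_graph_step G z : G !=set0 -> linear_graph G -> dominated G ->
  exists2 H, [/\ linear_graph H, dominated H & G `<=` H] & exists c, H (z, c).
Proof.
move=> [[x0 a0] G0] lG dG.
have G00 : G (0, 0).
  by have := lG (-1) _ _ G0 G0; rewrite /= scaleN1r mulN1r !addNr.
have cross x a y b : G (x, a) -> G (y, b) -> a - p (x - z) <= p (y + z) - b.
  move=> Gx Gy; have := lG 1 _ _ Gx Gy; move/dG => /=; rewrite scale1r mul1r.
  have := pD (x - z) (y + z); rewrite addrACA addNr addr0; lra.
pose A := [set q.2 - p (q.1 - z) | q in G].
have supA : has_sup A.
  split; first by exists (a0 - p (x0 - z)), (x0, a0).
  by exists (p (0 + z) - 0) => _ [[x a] Gx <-]; exact: cross.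
pose c := sup A.
have c_ge x a : G (x, a) -> a - p (x - z) <= c.
  by move=> Gx; apply: sup_ubound; [case: supA|exists (x, a)].
have c_le y b : G (y, b) -> c <= p (y + z) - b.
  move=> Gy; apply: ge_sup; first by case: supA.
  by move=> _ [[x a] Gx <-]; exact: cross.
have GZ t x a : G (x, a) -> G (t *: x, t * a).
  by move=> Gx; have := lG t _ _ Gx G00; rewrite /= !addr0.
pose H := [set q : V * R | exists x a t, G (x, a) /\ q = (x + t *: z, a + t * c)].
exists H; last by exists c; exists 0, 0, 1; rewrite scale1r mul1r !add0r.
split.
- move=> t _ _ [x [a [s [Gx ->]]]] [y [b [r [Gy ->]]]].
  exists (t *: x + y), (t * a + b), (t * s + r); split; first exact: (lG t _ _ Gx Gy).
  congr pair => /=; last by ring.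
  by rewrite scalerDr scalerA scalerDl addrACA.
- move=> _ [x [a [t [Gx ->]]]] /=.
  have [t0|t0|->] := ltgtP t 0; last by rewrite scale0r mul0r !addr0; exact: dG Gx.
  + have := c_ge _ _ (GZ (- t)^-1 _ _ Gx).
    have -> : x + t *: z = (- t) *: ((- t)^-1 *: x - z).
      by rewrite scalerBr scalerA divff ?oppr_eq0 ?lt_eqF// scale1r scaleNr opprK.
    rewrite pZ; last by rewrite oppr_ge0 ltW.
    move=> h.
    have : (- t) * ((- t)^-1 * a - p ((- t)^-1 *: x - z)) <= (- t) * c.
      by rewrite ler_wpM2l// oppr_ge0 ltW.
    rewrite mulrBr mulrA divff ?oppr_eq0 ?lt_eqF// mul1r !mulNr => {h} h; lra.
  + have := c_le _ _ (GZ t^-1 _ _ Gx).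
    have -> : x + t *: z = t *: (t^-1 *: x + z).
      by rewrite scalerDr scalerA divff ?gt_eqF// scale1r.
    rewrite pZ; last exact: ltW.
    move=> h.
    have : t * c <= t * (p (t^-1 *: x + z) - t^-1 * a) by rewrite ler_wpM2l// ltW.
    rewrite mulrBr mulrA divff ?gt_eqF// mul1r => {h} h; lra.
- by move=> [x a] Gx; exists x, a, 0; rewrite scale0r mul0r !addr0.
Qed.

Lemma real_hahn_banach (G : set (V * R)) :
  G !=set0 -> linear_graph G -> dominated G ->
  exists f : V -> R, [/\ scalar f, forall x, f x <= p x &
    forall q, G q -> f q.1 = q.2].
Proof.
move=> G0 lG dG.
(* G is joined to H rather than required to be a part of it, so that the empty
   chain causes no exception. *)
pose P (H : set (V * R)) := linear_graph (G `|` H) /\ dominated (G `|` H).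
have [F FP totF|H [[lH dH] Hmax]] := @Zorn_bigcup _ P.
  split=> [t q r Gq Gr|q [/dG//|[E FE Eq]]]; last by apply: (FP _ FE).2; right.
  have in_common q' r' : (G `|` \bigcup_(X in F) X) q' ->
      (G `|` \bigcup_(X in F) X) r' ->
      (G q' /\ G r') \/ exists E, [/\ F E, (G `|` E) q' & (G `|` E) r'].
    move=> [Gq'|[E FE Eq']] [Gr'|[D FD Dr']]; first by left.
    + by right; exists D; split; [|left|right].
    + by right; exists E; split; [|right|left].
    + right; have [ED|DE] := totF _ _ FE FD.
        by exists D; split => //; right => //; exact: ED.
      by exists E; split => //; right => //; exact: DE.
  have [[Gq' Gr']|[E [FE Eq Er]]] := in_common _ _ Gq Gr; first by left; exact: lG.
  have [lE _] := FP _ FE.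
  by have [GE|EE] := lE t _ _ Eq Er; [left|right; exists E].
pose H' := G `|` H.
have H'0 : H' !=set0 by have [q Gq] := G0; exists q; left.
have tot z : exists c, H' (z, c).
  have [E [lE dE sE] [c Ezc]] := @dominated_graph_step H' z H'0 lH dH.
  exists c; apply: contrapT => nH.
  have GE : G `|` E = E by apply/setUidPr => q Gq; apply: sE; left.
  apply: (Hmax E); last by split; rewrite GE.
  split; first by move=> q Hq; apply: sE; right.
  by move=> EH; apply: nH; right; exact: EH.
have [f fP] := choice tot; exists f; split.
- move=> t x y; apply: (@dominated_graph_fun H' (t *: x + y)) => //.
  exact: (lH t _ _ (fP x) (fP y)).
- by move=> x; exact: dH (fP x).
- move=> [x a] Gx; apply: (@dominated_graph_fun H' x) => //=; by left.
Qed.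

End real_hahn_banach.

(** * What the real and the complex scalars have in common *)

Definition hahn_banach (K : numFieldType) : Prop :=
  forall (X : normedModType K) (G : set (X * K)), G !=set0 -> linear_graph G ->
    (forall q, G q -> `|q.2| <= `|q.1|) ->
  exists f : X -> K, [/\ scalar f, forall x, `|f x| <= `|x| &
    forall q, G q -> f q.1 = q.2].

(** Everything that is used about the scalar field beyond the axioms of a number
    field.  The order of the complex numbers is partial, hence the restriction of
    the first two clauses to elements x with 0 <= x. *)
Record complete_scalars (K : numFieldType) : Prop := CompleteScalars {
  scalars_lub : forall (A : set K) (b : K), A !=set0 ->
    (forall x, A x -> 0 <= x <= b) -> exists s, isLub A s;
  scalars_archimedean : forall x : K, 0 <= x -> exists n : nat, x < n%:R;
  scalars_separable : exists q : nat -> K, forall (z e : K), 0 < e ->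
    exists n, `|z - q n| < e;
  scalars_ball_compact : forall M : K, compact [set z : K | `|z| <= M];
  scalars_hahn_banach : hahn_banach K }.

Section real.
Context (R : realType).

Lemma real_separable : exists q : nat -> R, forall z e, 0 < e ->
  exists n, `|z - q n| < e.
Proof.
exists (fun n => if @unpickle rat n is Some r then ratr r else 0) => z e e0.
have [|r] := @rat_in_itvoo R (z - e) (z + e); first by rewrite ltrBlDr -addrA ltrDl addr_gt0.
rewrite in_itv/= => /andP[h1 h2]; exists (pickle r); rewrite pickleK.
by rewrite ltr_norml; apply/andP; split; lra.
Qed.

Lemma real_complete_scalars : complete_scalars R.
Proof.
split.
- move=> A b A0 Ab; exists (sup A).
  have sA : has_sup A by split => //; exists b => x /Ab/andP[].
  by split=> [x Ax|c Ac]; [by apply: sup_ubound => //; case: sA|by apply: ge_sup].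
- by move=> x x0; exists (Num.bound x); rewrite archi_boundP.
- exact: real_separable.
- move=> M; rewrite (_ : [set _ | _] = `[- M, M]%classic); first exact: segment_compact.
  by apply/seteqP; split => x /=; rewrite in_itv/= ler_norml.
- move=> X G G0 lG dG.
  have ND (x y : X) : `|x + y| <= `|x| + `|y| by exact: ler_normD.
  have NZ (t : R) (x : X) : 0 <= t -> `|t *: x| = t * `|x|.
    by move=> t0; rewrite normrZ ger0_norm.
  have dR q : G q -> q.2 <= `|q.1| by move=> Gq; rewrite (le_trans (ler_norm _))// dG.
  have [f [sf fN fG]] := real_hahn_banach ND NZ G0 lG dR.
  exists f; split => // x; rewrite ler_norml fN andbT.
  have fNx : f (- x) = - f x.
    have f0 : f 0 = 0.
      by have := sf 1 0 0; rewrite scale1r addr0 mul1r => /eqP; rewrite -subr_eq subrr => /eqP.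
    by have := sf (-1) x 0; rewrite scaleN1r addr0 mulN1r f0 addr0.
  by rewrite lerNl -fNx (le_trans (fN _))// normrN.
Qed.

End real.

Lemma closed_norm_ball (K : numFieldType) (M : K) : closed [set z : K | `|z| <= M].
Proof.
move=> z /= clz; apply/ler_addgt0Pr => e e0.
have [y [/= yM]] := clz _ (nbhsx_ballx z e e0).
rewrite -ball_normE/= => zy.
rewrite -(subrK y z) addrC (le_trans (ler_normD _ _))// lerD//.
exact: ltW.
Qed.

Section complex.
Context (R : realType).
Local Notation C := (R[i] : numFieldType).
Local Notation re := (@complex.Re R).
Local Notation im := (@complex.Im R).
Local Open Scope complex_scope.

Definition realified (X : lmodType C) : Type := X.
Section realified.
Context (X : lmodType C).
HB.instance Definition _ := GRing.Zmodule.on (realified X).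

Definition realified_scale (t : R) (x : realified X) : realified X :=
  t%:C *: (x : X).

Lemma realified_scaleA a b x :
  realified_scale a (realified_scale b x) = realified_scale (a * b) x.
Proof. by rewrite /realified_scale scalerA rmorphM. Qed.
Lemma realified_scale1 x : realified_scale 1 x = x.
Proof. by rewrite /realified_scale scale1r. Qed.
Lemma realified_scaleDr a : {morph realified_scale a : x y / x + y}.
Proof. by move=> x y; rewrite /realified_scale scalerDr. Qed.
Lemma realified_scaleDl x : {morph realified_scale^~ x : a b / a + b}.
Proof. by move=> a b; rewrite /realified_scale rmorphD scalerDl. Qed.

HB.instance Definition _ := GRing.Zmodule_isLmodule.Build R (realified X)
  realified_scaleA realified_scale1 realified_scaleDr realified_scaleDl.
End realified.

Lemma Re_norm_real (X : normedModType C) (x : X) : (re `|x|)%:C = `|x|.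
Proof. by rewrite RRe_real// normr_real. Qed.

(** The real part of a complex functional f determines it through
    f x = Re (f x) - i Re (f (i x)), so it is enough to extend the real part. *)
Lemma complex_hahn_banach : hahn_banach C.
Proof.
move=> X G [[x0 a0] G0] lG dG.
have GZ t q : G q -> G (t *: q.1, t * q.2).
  (* t q = (t - 1) q + q: the graph is only known to be closed under t p + q. *)
  move=> Gq; have := lG (t - 1) _ _ Gq Gq.
  by rewrite -{2}(scale1r q.1) -{2}(mul1r q.2) -scalerDl -mulrDl subrK.
pose H : set (realified X * R) := [set q | exists2 a : C, G (q.1 : X, a) & q.2 = re a].
have ND (x y : realified X) : re `|(x + y : X)| <= re `|(x : X)| + re `|(y : X)|.
  by rewrite -lecR rmorphD /= !Re_norm_real; exact: ler_normD.
have NZ (t : R) (x : realified X) : 0 <= t ->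
    re `|(t *: x : X)| = t * re `|(x : X)|.
  move=> t0; apply: complexI; rewrite rmorphM /= !Re_norm_real /=.
  by rewrite /GRing.scale /= /realified_scale normrZ ger0_norm ?ler0c.
have H0 : H !=set0 by exists (x0, re a0), a0.
have lH : linear_graph H.
  move=> t [x b] [y c] [a /= Ga ->] [d /= Gd ->]; exists (t%:C * a + d) => /=.
    exact: (lG t%:C _ _ Ga Gd).
  by rewrite raddfD; case: (a) => ? ?; simpc.
have dH q : H q -> q.2 <= re `|(q.1 : X)|.
  move=> [a Ga ->]; rewrite -lecR Re_norm_real.
  apply: le_trans (dG _ Ga) => /=; rewrite normc_def lecR.
  rewrite (le_trans (ler_norm _))// -sqrtr_sqr ler_sqrt.
    by rewrite lerDl sqr_ge0.
  by rewrite addr_ge0 ?sqr_ge0.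
have [u [su uN uG]] := real_hahn_banach ND NZ H0 lH dH.
have uD x y : u (x + y) = u x + u y by have := su 1 x y; rewrite scale1r mul1r.
have u0 : u 0 = 0 by have := uD 0 0; rewrite addr0 => /eqP; rewrite -subr_eq subrr => /eqP.
have uZ t (x : X) : u (t%:C *: x) = t * u x by have := su t x 0; rewrite !addr0 u0 addr0.
have uNx x : u (- x) = - u x by apply/eqP; rewrite -subr_eq0 opprK -uD addNr u0.
pose f (x : X) : C := u x -i* u ('i *: x).
have fD x y : f (x + y) = f x + f y.
  by rewrite /f scalerDr !uD; apply/eqP; rewrite eq_complex /= opprD !eqxx.
have fi x : f ('i *: x) = 'i * f x.
  rewrite /f scalerA -expr2 sqr_i scaleN1r uNx.
  by apply/eqP; rewrite eq_complex /=; apply/andP; split; apply/eqP; ring.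
have fr t x : f (t%:C *: x) = t%:C * f x.
  rewrite /f scalerA mulrC -scalerA !uZ.
  by apply/eqP; rewrite eq_complex /=; apply/andP; split; apply/eqP; ring.
have fZ c x : f (c *: x) = c * f x.
  by rewrite {1}[c]complexE scalerDl fD -scalerA fi !fr mulrA -mulrDl -complexE.
have fG q : G q -> f q.1 = q.2.
  move=> Gq; have /uG /= h1 : H (q.1, re q.2) by exists q.2 => //; case: q Gq.
  have /uG /= h2 : H ('i *: q.1, re ('i * q.2)) by exists ('i * q.2) => //; exact: GZ.
  rewrite /f h1 h2; case: (q.2) => a b.
  by apply/eqP; rewrite eq_complex /=; apply/andP; split; apply/eqP; ring.
exists f; split => //; first by move=> c x y; rewrite fD fZ.
move=> x; have [->|fx0] := eqVneq (f x) 0; first by rewrite normr0.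
(* Rotating x by a scalar of modulus 1 makes f x real and nonnegative. *)
pose c := (f x)^-1 * `|f x|.
have c1 : `|c| = 1 by rewrite /c normrM normfV normr_id mulVf ?normr_eq0.
have : re (f (c *: x)) <= re `|c *: x| by exact: uN.
by rewrite normrZ c1 mul1r -lecR Re_norm_real fZ /c mulrAC mulVf// mul1r RRe_real ?normr_real.
Qed.

Let CC : numFieldType := C.

Lemma complex_norm_le (a b : R) : `|(a +i* b : C)| <= (`|a| + `|b|)%:C.
Proof.
have -> : a +i* b = a%:C + 'i * b%:C by rewrite {1}[a +i* b]complexE.
have norm_real c : `|c%:C : C| = `|c|%:C.
  by rewrite normc_def /= -sqrtr_sqr; congr (Num.sqrt _)%:C; ring.
have norm_i : `|'i : C| = 1.
  rewrite normc_def /= (_ : 0 ^+ 2 + 1 ^+ 2 = 1); last by ring.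
  by rewrite sqrtr1.
by rewrite (le_trans (ler_normD _ _))// normrM rmorphD/= !norm_real norm_i mul1r.
Qed.

Lemma Re_norm_le (z : C) : `|re z|%:C <= `|z|.
Proof.
rewrite normc_def lecR -sqrtr_sqr ler_sqrt ?lerDl ?sqr_ge0//.
by rewrite addr_ge0 ?sqr_ge0.
Qed.

Lemma Im_norm_le (z : C) : `|im z|%:C <= `|z|.
Proof.
rewrite normc_def lecR -sqrtr_sqr ler_sqrt ?lerDr ?sqr_ge0//.
by rewrite addr_ge0 ?sqr_ge0.
Qed.

Lemma complex_ball_compact (M : CC) : compact [set z : CC | `|z| <= M].
Proof.
pose S := `[- re M, re M]%classic : set R.
pose g (p : R * R) : CC := p.1 +i* p.2.
have gc : continuous g.
  move=> [a b]; apply/(@cvgrPdist_lt CC CC) => e e0.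
  have eR : e = (re e)%:C by rewrite RRe_real// gtr0_real.
  have e2 : 0 < re e / 2 by rewrite divr_gt0// -ltcR -eR.
  near=> p.
  have -> : g (a, b) - g p = (a - p.1) +i* (b - p.2).
    by apply/eqP; rewrite eq_complex /= !eqxx.
  apply: (le_lt_trans (complex_norm_le _ _)); rewrite eR ltcR (splitr (re e)) ltrD//.
    near: p; apply: (@cvgr_dist_lt _ _ _ _ _ fst a) => //; exact: cvg_fst.
  near: p; apply: (@cvgr_dist_lt _ _ _ _ _ snd b) => //; exact: cvg_snd.
apply: (@subclosed_compact _ _ (g @` (S `*` S))).
- exact: closed_norm_ball.
- apply: continuous_compact; first exact: continuous_subspaceT.
  by apply: compact_setX; exact: segment_compact.
- move=> z /= zM.
  have MR : M = (re M)%:C by rewrite RRe_real// ger0_real// (le_trans (normr_ge0 z)).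
  exists (re z, im z); last by rewrite /g; case: (z).
  rewrite MR in zM.
  rewrite /S set_itvcc; split => /=; rewrite -ler_norml -lecR; apply: le_trans zM.
    exact: Re_norm_le.
  exact: Im_norm_le.
Unshelve. all: by end_near. Qed.

Lemma complex_complete_scalars : complete_scalars C.
Proof.
have reK (x : C) : 0 <= x -> x = (re x)%:C by move=> x0; rewrite RRe_real// ger0_real.
split.
- move=> A b A0 Ab.
  have A_real x : A x -> x = (re x)%:C by move=> /Ab/andP[/reK].
  have b_real : b = (re b)%:C.
    by have [x /Ab/andP[x0 xb]] := A0; apply/reK/(le_trans x0).
  pose B := [set re x | x in A].
  have sB : has_sup B.
    split; first by have [x Ax] := A0; exists (re x), x.
    exists (re b) => _ [x Ax <-]; rewrite -lecR -A_real// -b_real.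
    by have /andP[] := Ab _ Ax.
  exists (sup B)%:C; split.
    move=> x Ax; rewrite (A_real _ Ax) lecR; apply: sup_ubound; first by case: sB.
    by exists x.
  move=> c Ac.
  have c_real : c = (re c)%:C.
    have [x Ax] := A0; apply: reK; apply: le_trans (Ac _ Ax).
    by have /andP[] := Ab _ Ax.
  rewrite c_real lecR; apply: ge_sup; first by case: sB.
  by move=> _ [x Ax <-]; rewrite -lecR -A_real// -c_real; exact: Ac.
- move=> x x0; have xR := reK _ x0; have Rx0 : 0 <= re x by rewrite -lecR -xR.
  exists (Num.bound (re x)).
  have -> : ((Num.bound (re x))%:R : C) = ((Num.bound (re x))%:R)%:C by rewrite rmorph_nat.
  by rewrite xR ltcR archi_boundP.
- have [q hq] := real_separable R.
  exists (fun n => if @unpickle (nat * nat)%type n is Some p then q p.1 +i* q p.2 else 0).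
  move=> z e e0.
  have eR : e = (re e)%:C by rewrite RRe_real// gtr0_real.
  have e2 : 0 < re e / 2 by rewrite divr_gt0// -ltcR -eR.
  have [n hn] := hq (re z) _ e2; have [m hm] := hq (im z) _ e2.
  exists (pickle (n, m)); rewrite pickleK /=.
  have -> : z - (q n +i* q m) = (re z - q n) +i* (im z - q m).
    by case: (z).
  by apply: (le_lt_trans (complex_norm_le _ _)); rewrite eR ltcR (splitr (re e)) ltrD.
- exact: complex_ball_compact.
- exact: complex_hahn_banach.
Qed.

End complex.

Lemma scalar_field_complete (R : realType) (K : numFieldType) :
  scalar_field R K -> complete_scalars K.
Proof.
by case; [exact: real_complete_scalars|exact: complex_complete_scalars].
Qed.

(** * The dual norm and the compactness of the dual ball *)

Section scalar_facts.
Context {K : numFieldType} {X : lmodType K}.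
Implicit Type f : X -> K.

Lemma scalarD f x y : scalar f -> f (x + y) = f x + f y.
Proof. by move=> sf; have := sf 1 x y; rewrite scale1r mul1r. Qed.

Lemma scalar0 f : scalar f -> f 0 = 0.
Proof.
by move=> sf; have := scalarD 0 0 sf; rewrite addr0 => /eqP;
  rewrite -subr_eq subrr => /eqP.
Qed.

Lemma scalarZ f a x : scalar f -> f (a *: x) = a * f x.
Proof. by move=> sf; have := sf a x 0; rewrite !addr0 (scalar0 sf) addr0. Qed.

Lemma scalarB f x y : scalar f -> f (x - y) = f x - f y.
Proof. by move=> sf; rewrite -scaleN1r scalarD// scalarZ// mulN1r. Qed.

Lemma scalar_sum (I : Type) (r : seq I) (P : pred I) (F : I -> X) f :
  scalar f -> f (\sum_(i <- r | P i) F i) = \sum_(i <- r | P i) f (F i).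
Proof.
move=> sf; elim/big_rec2: _ => [|i a b _ <-]; first exact: scalar0.
by rewrite scalarD.
Qed.

Lemma scalar_sub f g : scalar f -> scalar g -> scalar (f \- g).
Proof. by move=> sf sg a x y /=; rewrite sf sg; ring. Qed.

End scalar_facts.

Section dual_facts.
Context {K : numFieldType} {X : normedModType K}.
Implicit Types (f g : X -> K) (x : X).

Lemma dual_scalar f : dual f -> scalar f. Proof. by case. Qed.

Lemma dual_bounded f : dual f -> exists2 M, 0 <= M & forall x, `|f x| <= M * `|x|.
Proof.
move=> [sf cf]; pose fl : {linear X -> K^o} := HB.pack f (GRing.isLinear.Build _ _ _ _ f sf).
have /linear_boundedP [M [Mr hM]] : bounded_near fl (nbhs (0 : X)).
  by apply/linear_bounded_continuous.
exists (`|M| + 1); first by rewrite addr_ge0.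
by move=> x; apply: hM; rewrite (le_lt_trans (real_ler_norm Mr))// ltrDl.
Qed.

Lemma bounded_dual f M : scalar f -> (forall x, `|f x| <= M * `|x|) -> dual f.
Proof.
move=> sf fM; split => //.
pose fl : {linear X -> K^o} := HB.pack f (GRing.isLinear.Build _ _ _ _ f sf).
apply/(linear_bounded_continuous fl)/linear_boundedP.
exists `|M|; split; first exact: normr_real.
move=> r Mr x; apply: (le_trans (fM x)).
have [->|x0] := eqVneq x 0; first by rewrite normr0 !mulr0.
have xp : 0 < `|x| by rewrite normr_gt0.
have M0 : 0 <= M by have := le_trans (normr_ge0 _) (fM x); rewrite pmulr_lge0.
by rewrite ler_wpM2r// -(ger0_norm M0) ltW.
Qed.

Lemma dual_sub f g : dual f -> dual g -> dual (f \- g).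
Proof.
move=> df dg; have [M _ fM] := dual_bounded df; have [N _ gN] := dual_bounded dg.
apply: (@bounded_dual _ (M + N)); first by apply: scalar_sub; exact: dual_scalar.
by move=> x /=; rewrite (le_trans (ler_normB _ _))// mulrDl lerD.
Qed.

Lemma dual_lin (a : K) (f g : X -> K) : dual f -> dual g -> dual (fun x => a * f x + g x).
Proof.
move=> df dg; have [M _ fM] := dual_bounded df; have [N _ gN] := dual_bounded dg.
apply: (@bounded_dual _ (`|a| * M + N)).
  by move=> t x z /=; rewrite (dual_scalar df) (dual_scalar dg); ring.
move=> x /=; rewrite (le_trans (ler_normD _ _))// mulrDl lerD// normrM -mulrA.
by rewrite ler_wpM2l.
Qed.

Lemma dual0 : dual (fun _ : X => 0 : K).
Proof.
by apply: (@bounded_dual _ 0) => [a x z|x]; rewrite ?mulr0 ?addr0// normr0 mul0r.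
Qed.

Lemma dual_sum (I : Type) (s : seq I) (P : pred I) (a : I -> K) (f : I -> X -> K) :
  (forall i, P i -> dual (f i)) -> dual (fun x => \sum_(i <- s | P i) a i * f i x).
Proof.
move=> df; elim: s => [|i s IH].
  rewrite (_ : (fun _ => _) = fun=> 0); first exact: dual0.
  by apply/funext => x; rewrite big_nil.
have [Pi|Pi] := boolP (P i); last first.
  rewrite (_ : (fun _ => _) = (fun x => \sum_(i <- s | P i) a i * f i x))//.
  by apply/funext => x; rewrite big_cons (negbTE Pi).
rewrite (_ : (fun _ => _) = (fun x => a i * f i x + \sum_(i <- s | P i) a i * f i x)).
  exact: (dual_lin _ (df _ Pi) IH).
by apply/funext => x; rewrite big_cons Pi.
Qed.

Section complete.
Hypothesis hK : complete_scalars K.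

Lemma dual_norm_lub f : dual f ->
  isLub [set `|f x| | x in [set x : X | `|x| <= 1]] (dual_norm f).
Proof.
move=> df; have [M M0 fM] := dual_bounded df.
set A := [set _ | _ in _].
have A0 : A !=set0 by exists `|f 0|, 0 => //=; rewrite normr0.
have [s [s1 s2]] : exists s, isLub A s.
  apply: (scalars_lub hK (b := M)) => // _ [x /= x1 <-].
  by rewrite normr_ge0 (le_trans (fM _))// ler_piMr.
suff -> : dual_norm f = s by [].
rewrite /dual_norm /supremum ifF; last exact/negbTE/set0P.
have := xgetPex (0 : K) (ex_intro (supremums A) s (conj s1 s2)).
by set t := xget _ _ => -[t1 t2]; apply/eqP; rewrite eq_le s2//= t2.
Qed.

Lemma dual_norm_le f c : dual f -> (forall x, `|x| <= 1 -> `|f x| <= c) ->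
  dual_norm f <= c.
Proof. by move=> df h; apply: (dual_norm_lub df).2 => _ [x x1 <-]; exact: h. Qed.

Lemma dual_norm_ge0 f : dual f -> 0 <= dual_norm f.
Proof.
move=> df; apply: le_trans (normr_ge0 (f 0)) _; apply: (dual_norm_lub df).1.
by exists 0 => //=; rewrite normr0.
Qed.

Lemma le_dual_norm f x : dual f -> `|f x| <= dual_norm f * `|x|.
Proof.
move=> df; have [->|x0] := eqVneq x 0.
  by rewrite scalar0 ?normr0 ?mulr0//; exact: dual_scalar.
have xp : 0 < `|x| by rewrite normr_gt0.
rewrite -ler_pdivrMr// -{1}(gtr0_norm xp) -normfV -normrM mulrC.
rewrite -scalarZ; last exact: dual_scalar.
apply: (dual_norm_lub df).1; exists (`|x|^-1 *: x) => //=.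
by rewrite normrZ normfV normr_id mulVf ?gt_eqF.
Qed.

Lemma lt_dual_norm f c : dual f -> c < dual_norm f ->
  exists2 x, `|x| <= 1 & c < `|f x|.
Proof.
move=> df cf; apply: contrapT => h.
suff : dual_norm f <= c by move=> /(lt_le_trans cf); rewrite ltxx.
apply: dual_norm_le => // x x1.
rewrite real_leNgt ?normr_real//; first by apply/negP => fx; apply: h; exists x.
rewrite -(subKr (dual_norm f) c) realB ?ger0_real ?dual_norm_ge0//.
by rewrite subr_ge0 ltW.
Qed.

Lemma dual_ballP f : dual_ball f <-> scalar f /\ forall x, `|f x| <= `|x|.
Proof.
split=> [[df f1]|[sf f1]].
  split; first exact: dual_scalar.
  move=> x; apply: le_trans (le_dual_norm _ df) _.
  by rewrite ler_piMl.
have df : dual f by apply: (@bounded_dual _ 1) => // x; rewrite mul1r.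
by split => //; apply: dual_norm_le => // x; apply: le_trans.
Qed.

(** Reduces norm diameters to point evaluations, the only way in which they are
    used. *)
Lemma diam_gtP (A : set (X -> K)) (c : K) : A `<=` @dual K X ->
  diam_gt A c <-> exists f g x, [/\ A f, A g, `|x| <= 1 & c < `|f x - g x|].
Proof.
move=> dA; split=> [[f [g [Af Ag fg]]]|[f [g [x [Af Ag x1 fgx]]]]].
  have [x x1 fgx] := lt_dual_norm (dual_sub (dA _ Af) (dA _ Ag)) fg.
  by exists f, g, x.
exists f, g; split => //; apply: (lt_le_trans fgx).
apply: le_trans (@le_dual_norm (f \- g) x _) _; first by apply: dual_sub; exact: dA.
by rewrite ler_piMr// dual_norm_ge0//; apply: dual_sub; exact: dA.
Qed.

Lemma eval_continuous (x : X) : continuous (fun f : {ptws X -> K} => f x).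
Proof. exact: (@proj_continuous X (fun=> K) x). Qed.

Lemma linearity_defect_continuous (a : K) (x y : X) :
  continuous (fun f : {ptws X -> K} => f (a *: x + y) - (a * f x + f y)).
Proof.
move=> f; have ev z := @eval_continuous z f.
have h : (fun g : {ptws X -> K} => a * g x) @ nbhs f --> a * f x.
  exact: cvgM (cvg_cst a) (ev x).
exact: cvgB (ev (a *: x + y)) (cvgD h (ev y)).
Qed.

(** Linearity and the bound by the norm are closed conditions on finitely many
    evaluations each. *)
Lemma dual_ball_closed : closed (@dual_ball K X : set {ptws X -> K}).
Proof.
pose E (q : K * X * X) := [set f : {ptws X -> K} |
    f (q.1.1 *: q.1.2 + q.2) - (q.1.1 * f q.1.2 + f q.2) = 0].
pose B x := [set f : {ptws X -> K} | `|f x| <= `|x|].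
rewrite (_ : dual_ball = \bigcap_(q in setT) E q `&` \bigcap_(x in setT) B x); last first.
  apply/seteqP; split => f /= => [/dual_ballP[sf f1]|[h1 h2]].
    by split=> [q _|x _]; [rewrite /E/= sf subrr|exact: f1].
  apply/dual_ballP; split=> [a x y|x]; last exact: h2.
  by apply/eqP; rewrite -subr_eq0; apply/eqP; exact: (h1 (a, x, y)).
apply: closedI.
  apply: closed_bigI => -[[a x] y] _.
  apply: (@closed_comp _ _ _ [set 0 : K]).
    by move=> f _; exact: linearity_defect_continuous.
  exact/accessible_closed_set1/hausdorff_accessible/norm_hausdorff.
apply: closed_bigI => x _.
apply: (@closed_comp _ _ (fun f : {ptws X -> K} => f x) [set z : K | `|z| <= `|x|]).
  by move=> f _; exact: eval_continuous.
exact: closed_norm_ball.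
Qed.

(** Alaoglu's theorem, by Tychonoff's theorem for a product of scalar balls. *)
Lemma dual_ball_compact : compact (@dual_ball K X : set {ptws X -> K}).
Proof.
apply: (@subclosed_compact _ _
    ([set f : {ptws X -> K} | forall x, [set z : K | `|z| <= `|x|] (f x)])).
- exact: dual_ball_closed.
- apply: (@tychonoff X (fun=> K) (fun x => [set z : K | `|z| <= `|x|])) => x.
  exact: (scalars_ball_compact hK).
- by move=> f /dual_ballP[].
Qed.

End complete.
End dual_facts.

(** * Ordinals, pointwise topology and Szlenk derivatives *)

Lemma ord_cases (xi : ord) :
  [\/ xi = ozero, exists b, xi = osucc b | olimit xi].
Proof.
have [|xi0] := leP xi ozero.
  by move=> xi0; apply: Or31; apply/eqP; rewrite eq_le xi0 ozero_le.
have [h|h] := pselect (forall b, (b < xi)%O -> (osucc b < xi)%O).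
  by apply: Or33.
apply: Or32; move/existsNP: h => [b /not_implyP[bxi /negP]].
rewrite -leNgt => xib; exists b; apply/eqP.
by rewrite eq_le xib osucc_le.
Qed.

Lemma lt_osucc (b : ord) : (b < osucc b)%O.
Proof. by rewrite -osucc_le. Qed.

Lemma ord_least (A : set ord) : A !=set0 ->
  exists2 xi, A xi & forall z, A z -> (xi <= z)%O.
Proof.
move=> [a]; elim/(well_founded_ind olt_wf): a => a IH Aa.
have [[b [Ab ba]]|h] := pselect (exists b, A b /\ (b < a)%O); first exact: IH Ab.
exists a => // z Az; rewrite leNgt; apply/negP => za; apply: h; by exists z.
Qed.

Lemma precomp_continuous (U V : topologicalType) (T : uniformType) (j : V -> U) :
  continuous (fun f : {ptws U -> T} => (f \o j : {ptws V -> T})).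
Proof.
move=> f.
have FF := @fmap_filter _ _ (fun f : {ptws U -> T} => (f \o j : {ptws V -> T})) _ (nbhs_filter f).
apply/(@pointwise_cvgP V T _ (f \o j) FF) => v.
exact: (@proj_continuous U (fun=> T) (j v) f).
Qed.

(** The filter generated by the boxes around f converges pointwise to f, hence
    in the product topology, so it contains all neighbourhoods of f. *)
Lemma ptws_nbhs_box (K : numFieldType) (U : topologicalType) (f : {ptws U -> K})
    (V : set {ptws U -> K}) : nbhs f V ->
  exists s : seq U, exists2 e : K, 0 < e &
    forall g, (forall u, u \in s -> `|f u - g u| < e) -> V g.
Proof.
pose B (p : seq U * K) := [set g : U -> K | forall u, u \in p.1 -> `|f u - g u| < p.2].
pose F := filter_from [set p : seq U * K | 0 < p.2] B.
have FF : Filter F.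
  apply: filter_from_filter; first by exists ([::], 1) => /=.
  move=> [s a] [t b] /= a0 b0.
  have [c c0 [ca cb]] : exists2 c, 0 < c & c <= a /\ c <= b.
    by have /orP[ab|ba] := ger_leVge (ltW a0) (ltW b0); [exists a|exists b].
  exists (s ++ t, c) => // g gst; split => u us /=; [apply: lt_le_trans ca|apply: lt_le_trans cb];
    by apply: gst; rewrite mem_cat us ?orbT.
have Ff : F --> (f : {ptws U -> K}).
  apply/(@pointwise_cvgP U K F f FF) => u W.
  rewrite -nbhs_ballE => -[e /= e0 We]; exists ([:: u], e) => //= g gu.
  by apply: We; rewrite -ball_normE /=; apply: gu; rewrite inE.
move=> /Ff [[s e] /= e0 h]; exists s, e => // g gs; exact: h.
Qed.

Section derivatives.
Context {K : numFieldType} {X : normedModType K}.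
Implicit Types (C : set (X -> K)) (eps : K).

Lemma weak_star_openI (V : set {ptws X -> K}) :
  open V -> weak_star_open (V `&` @dual K X).
Proof. by move=> oV; exists V. Qed.

Lemma dual_ball_dual : @dual_ball K X `<=` @dual K X.
Proof. by move=> f []. Qed.

(** For sets of continuous functionals, weak-star open sets may be replaced by
    open sets of the whole product space. *)
Lemma szlenk_derivativeP eps C f : C `<=` @dual K X ->
  szlenk_derivative eps C f <->
  C f /\ forall V : set {ptws X -> K}, open V -> V f -> diam_gt (V `&` C) eps.
Proof.
move=> Cd; split=> -[Cf h]; split => //.
  move=> V oV Vf.
  have [|g [k [[[Vg _] Cg] [[Vk _] Ck] gk]]] := h _ (weak_star_openI oV).
    by split => //; exact: Cd.
  by exists g, k.
move=> _ [V oV ->] [Vf _]; have [g [k [[Vg Cg] [Vk Ck] gk]]] := h V oV Vf.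
by exists g, k; split => //; split => //; split => //; exact: Cd.
Qed.

Lemma diam_gt_le (A : set (X -> K)) (a b : K) :
  a <= b -> diam_gt A b -> diam_gt A a.
Proof.
by move=> ab [f [g [Af Ag fg]]]; exists f, g; split => //; exact: le_lt_trans fg.
Qed.

Lemma szlenk_derivative_closed eps C : C `<=` @dual K X ->
  closed (C : set {ptws X -> K}) ->
  closed (szlenk_derivative eps C : set {ptws X -> K}).
Proof.
move=> Cd cC f clf; apply/szlenk_derivativeP => //; split.
  by apply: cC => V Vf; have [g [[Cg _] Vg]] := clf V Vf; exists g.
move=> V oV Vf; have [g [/(szlenk_derivativeP _ _ Cd) [_ h] Vg]] :=
  clf V (open_nbhs_nbhs (conj oV Vf)).
exact: h.
Qed.

Lemma tree_derivative_closed eps C t : C `<=` @dual K X ->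
  closed (C : set {ptws X -> K}) ->
  closed (tree_derivative eps C t : set {ptws X -> K}).
Proof.
move=> Cd cC; elim: t => [//|t IH|I f IH] /=.
  by apply: szlenk_derivative_closed => //; apply: subset_trans Cd; exact: tree_derivative_sub.
by apply: closedI => //; apply: closed_bigI => i _; exact: IH.
Qed.

Lemma tree_derivative_le a b C t : a <= b ->
  tree_derivative b C t `<=` tree_derivative a C t.
Proof.
move=> ab; elim: t => [//|t IH|I f IH] /=.
  move=> g /(szlenk_derivative_mono IH) [Cg h]; split => // U oU Ug.
  exact: diam_gt_le ab (h U oU Ug).
by move=> g [Cg h]; split => // i _; exact/IH/h.
Qed.

Lemma szlenk_iter_sub eps C xi : szlenk_iter eps C xi `<=` C.
Proof. exact: tree_derivative_sub. Qed.

Section complete.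
Hypothesis hK : complete_scalars K.

Lemma szlenk_iter_ball_closed eps xi :
  closed (szlenk_iter eps (@dual_ball K X) xi : set {ptws X -> K}).
Proof.
by apply: tree_derivative_closed; [exact: dual_ball_dual|exact: dual_ball_closed].
Qed.

Local Notation level eps xi := (szlenk_iter eps (@dual_ball K X) xi).

(** The sets P /\ L(eps, z) for z < xi are a decreasing family of nonempty compact
    sets. *)
Lemma szlenk_iter_lim_meets eps xi (P : set {ptws X -> K}) :
  compact P -> P `<=` @dual_ball K X -> olimit xi ->
  (forall z, (z < xi)%O -> P `&` level eps z !=set0) ->
  P `&` level eps xi !=set0.
Proof.
move=> cP PB xil Pz.
pose B z := P `&` level eps z.
pose F := filter_from [set z | (z < xi)%O] B.
have xi0 : (ozero < xi)%O by case: xil.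
have FF : ProperFilter F.
  apply: filter_from_proper; last exact: Pz.
  apply: filter_from_filter; first by exists ozero.
  move=> i j /= ix jx; exists (Order.max i j); first by rewrite /= gt_max ix jx.
  move=> f [Pf fL]; split; split => //; apply: szlenk_iter_anti fL;
    by rewrite le_max lexx ?orbT.
have FP : F P by exists ozero => // f [].
have [f [Pf clf]] := cP F FF FP.
exists f; split => //; rewrite szlenk_iter_lim// => z zxi.
apply: (@szlenk_iter_ball_closed eps z) => V Vf.
have [|g [[_ gL] Vg]] := clf (B z) V _ Vf; first by exists z.
by exists g.
Qed.

(** The least ordinal at which P is missed is a successor, since it is neither 0
    nor, by compactness, a limit. *)
Lemma szlenk_last_level eps xi (P : set {ptws X -> K}) :
  compact P -> P `<=` @dual_ball K X -> P !=set0 ->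
  level eps xi = set0 ->
  exists z, [/\ (z < xi)%O, P `&` level eps z !=set0 &
    P `&` level eps (osucc z) = set0].
Proof.
move=> cP PB P0 xi0.
have [|a Pa amin] := @ord_least [set z | P `&` level eps z = set0].
  by exists xi; rewrite /= xi0 setI0.
have axi : (a <= xi)%O by apply: amin; rewrite /= xi0 setI0.
have lt_a z : (z < a)%O -> P `&` level eps z !=set0.
  by move=> za; apply/set0P/eqP => /amin; rewrite leNgt za.
have [a0|[b ab]|al] := ord_cases a.
- move: Pa; rewrite /= a0 szlenk_iter0 => Pa.
  have [f Pf] := P0; suff : (P `&` dual_ball) f by rewrite Pa.
  by split => //; exact: PB.
- exists b; split.
  + by apply: lt_le_trans axi; rewrite ab lt_osucc.
  + by apply: lt_a; rewrite ab lt_osucc.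
  + by rewrite -ab.
- have [f] := szlenk_iter_lim_meets cP PB al lt_a; by rewrite /= in Pa; rewrite Pa.
Qed.

End complete.
End derivatives.

(** * Restricting functionals to a subspace *)

Section restriction.
Context {K : numFieldType} {X : normedModType K} (Y : submodClosed X).
Hypothesis hK : complete_scalars K.
Local Notation Z := (subspace_type Y).

Definition restriction (f : X -> K) : Z -> K := fun y => f (\val y).

Lemma subspace_normE (y : Z) : `|y| = `|\val y|. Proof. by []. Qed.

Lemma restriction_scalar f : scalar f -> scalar (restriction f).
Proof. by move=> sf a x y; rewrite /restriction linearP sf. Qed.

Lemma restriction_dual f : dual f -> dual (restriction f).
Proof.
move=> df; have [M _ fM] := dual_bounded df.
apply: (@bounded_dual _ _ _ M); last by move=> y; exact: fM.
by apply/restriction_scalar/dual_scalar.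
Qed.

Lemma restriction_ball f : dual_ball f -> dual_ball (restriction f).
Proof.
move=> /(dual_ballP hK)[sf f1]; apply/(dual_ballP hK).
by split=> [|y]; [exact: restriction_scalar|exact: f1].
Qed.

Lemma restriction_continuous :
  continuous (restriction : {ptws X -> K} -> {ptws Z -> K}).
Proof.
exact: (@precomp_continuous X Z K val).
Qed.

Lemma hahn_banach_extension phi : @dual_ball K Z phi ->
  exists2 f, @dual_ball K X f & restriction f = phi.
Proof.
move=> /(dual_ballP hK)[sphi phi1].
pose G := [set q : X * K | exists2 y : Z, q.1 = \val y & q.2 = phi y].
have [||q [y q1 q2]|f [sf f1 fG]] := scalars_hahn_banach hK (X := X) (G := G).
- by exists (\val (0 : Z), phi 0), 0.
- move=> t [_ _] [_ _] [y /= -> ->] [z /= -> ->]; exists (t *: y + z) => /=.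
    exact: esym (linearP (\val : Z -> X) t y z).
  by rewrite sphi.
- by rewrite q1 q2; exact: phi1.
exists f; first exact/(dual_ballP hK).
by apply/funext => y; rewrite /restriction (fG (\val y, phi y))//; exists y.
Qed.

(** The image of the weak-star closure of A is compact, hence it contains phi; a
    preimage f of phi in that closure has points g of A in each neighbourhood,
    and f - g restricts to phi - g, which is large. *)
Lemma closure_restriction_lift eps (C A : set (X -> K)) phi :
  C `<=` @dual_ball K X -> closed (C : set {ptws X -> K}) -> A `<=` C ->
  (forall f, A f -> exists2 y : Z, `|y| <= 1 & eps < `|phi y - restriction f y|) ->
  closure (restriction @` A : set {ptws Z -> K}) phi ->
  exists2 f, szlenk_derivative eps C f & restriction f = phi.
Proof.
move=> CB cC AC Afar clphi.
pose A' : set {ptws X -> K} := A.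
have clAC : closure A' `<=` C.
  by move=> f clf; apply: cC => V /clf [g [/AC Cg Vg]]; exists g.
have cA : compact (closure A').
  apply: (subclosed_compact (@closed_closure _ A') (@dual_ball_compact K X hK)).
  exact: subset_trans CB.
pose r : {ptws X -> K} -> {ptws Z -> K} := restriction.
have cr : compact (r @` closure A').
  by apply: continuous_compact cA; apply/continuous_subspaceT/restriction_continuous.
have clr : closed (r @` closure A').
  by apply: compact_closed cr; apply: hausdorff_product => _; exact: norm_hausdorff.
have [f clf fphi] : (r @` closure A') phi.
  apply: clr => V /clphi [_ [[f Af <-] Vf]]; exists (r f); split => //.
  by exists f => //; exact: subset_closure.
exists f => //; apply/szlenk_derivativeP; first by move=> g /CB [].
split; first exact: clAC.
move=> V oV Vf; have [g [Ag Vg]] := clf V (open_nbhs_nbhs (conj oV Vf)).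
have Cd : V `&` C `<=` @dual K X by move=> h [_ /CB []].
apply/(diam_gtP hK _ Cd); have [y y1 yfar] := Afar _ Ag.
exists f, g, (\val y); split => //; last by rewrite -fphi in yfar.
  by split => //; exact: clAC.
by split => //; exact: AC.
Qed.

(** Otherwise phi would have a neighbourhood in which all restrictions of elements
    of C are within eps of phi, so of diameter at most 2 eps. *)
Lemma szlenk_derivative_restriction eps (C : set (X -> K)) (D : set (Z -> K)) :
  0 < eps -> C `<=` @dual_ball K X -> closed (C : set {ptws X -> K}) ->
  D `<=` restriction @` C ->
  szlenk_derivative (eps *+ 2) D `<=` restriction @` szlenk_derivative eps C.
Proof.
move=> eps0 CB cC DC phi; have Dd : D `<=` @dual K Z.
  by move=> _ /DC [f /CB [df _] <-]; exact: restriction_dual.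
move=> /(szlenk_derivativeP _ _ Dd) [Dphi h].
pose A := [set f | C f /\ exists2 y : Z, `|y| <= 1 & eps < `|phi y - restriction f y|].
suff : closure (restriction @` A : set {ptws Z -> K}) phi.
  have AC : A `<=` C by move=> f [].
  have Afar f : A f -> exists2 y : Z, `|y| <= 1 & eps < `|phi y - restriction f y|.
    by case.
  by move=> /(closure_restriction_lift CB cC AC Afar) [f sf <-]; exists f.
apply: contrapT => nclphi.
have : nbhs (phi : {ptws Z -> K}) (~` closure (restriction @` A : set {ptws Z -> K})).
  apply: open_nbhs_nbhs; split => //; exact/closed_openC/closed_closure.
rewrite nbhsE => -[V [oV Vphi] VA].
have /(diam_gtP hK) := h _ oV Vphi.
case=> [|g [k [y [[Vg Dg] [Vk Dk] y1 gk]]]]; first by move=> g [_ /Dd].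
have near g' : V g' -> D g' -> `|phi y - g' y| <= eps.
  move=> Vg' /DC [f Cf fg']; rewrite real_leNgt ?normr_real ?gtr0_real//.
  apply/negP => far; apply: (VA _ Vg'); apply: subset_closure.
  by exists f => //; split => //; exists y => //; rewrite fg'.
suff : `|g y - k y| <= eps *+ 2 by move=> /(lt_le_trans gk); rewrite ltxx.
rewrite -(subrKA (phi y)) (le_trans (ler_normD _ _))// mulr2n lerD ?near//.
by rewrite distrC near.
Qed.

Lemma fibre_compact (phi : Z -> K) :
  compact (@dual_ball K X `&` restriction @^-1` [set phi] : set {ptws X -> K}).
Proof.
apply: (subclosed_compact _ (@dual_ball_compact K X hK)); last by move=> f [].
apply: closedI; first exact: dual_ball_closed.
apply: (@closed_comp _ _ (restriction : {ptws X -> K} -> {ptws Z -> K})).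
  by move=> f _; exact: restriction_continuous.
apply/accessible_closed_set1/hausdorff_accessible/hausdorff_product => _.
exact: norm_hausdorff.
Qed.

Lemma szlenk_iter_restriction eps xi : 0 < eps ->
  szlenk_iter (eps *+ 2) (@dual_ball K Z) xi `<=`
  restriction @` szlenk_iter eps (@dual_ball K X) xi.
Proof.
move=> eps0; elim/(well_founded_ind olt_wf): xi => xi IH.
have [->|[b xib]|xil] := ord_cases xi.
- rewrite !szlenk_iter0 => phi /hahn_banach_extension[f Bf <-]; by exists f.
- rewrite xib !szlenk_iterS; apply: szlenk_derivative_restriction => //.
  + exact: szlenk_iter_sub.
  + exact: szlenk_iter_ball_closed.
  + by apply: IH; rewrite xib lt_osucc.
- move=> phi phixi.
  have cP := @fibre_compact phi.
  have PB : dual_ball `&` restriction @^-1` [set phi] `<=` @dual_ball K X by move=> f [].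
  have [|f [[_ fphi] fxi]] := szlenk_iter_lim_meets hK cP PB xil (eps := eps).
    move=> z zxi; have [f fz fphi] := IH _ zxi phi (szlenk_iter_anti (ltW zxi) phixi).
    by exists f; split => //; split => //; exact: szlenk_iter_sub fz.
  by exists f.
Qed.

End restriction.

(** * Finite sets of functionals and their common kernel *)

Lemma scalars_finite_net (K : numFieldType) : complete_scalars K ->
  forall M e : K, 0 < e ->
  exists s : seq K, forall z, `|z| <= M -> exists2 c, c \in s & `|z - c| < e.
Proof.
move=> hK M e e0; have := scalars_ball_compact hK (M := M).
rewrite compact_cover => /(_ K setT (fun c => ball c e)) [].
- by move=> c _; exact: ball_open.
- by move=> z _; exists z => //; exact: ballxx.
move=> D _ cov; exists (finmap.enum_fset D) => z /cov [c /= cD cz].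
by exists c => //; move: cz; rewrite -ball_normE /= distrC.
Qed.

Lemma nbhs_all_seq (T : topologicalType) (I : eqType) (f : T) (s : seq I)
    (P : I -> set T) :
  (forall i, i \in s -> nbhs f (P i)) ->
  nbhs f [set g | forall i, i \in s -> P i g].
Proof.
elim: s => [_|i s IH h].
  by apply: filterS filterT => g _ i; rewrite in_nil.
have : nbhs f (P i `&` [set g | forall j, j \in s -> P j g]).
  apply: filterI; first by apply: h; rewrite mem_head.
  by apply: IH => j js; apply: h; rewrite inE js orbT.
by apply: filterS => g [Pi Ps] j; rewrite inE => /predU1P[->//|/Ps].
Qed.

Section annihilator.
Context {K : numFieldType} {X : normedModType K}.
Hypothesis hK : complete_scalars K.
Implicit Types (F : seq (X -> K)) (f h : X -> K).

Definition annihilator F : set X := [set x | forall h, h \in F -> h x = 0].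

Definition all_dual F := forall h, h \in F -> dual h.

Lemma all_dual_cons h F : all_dual (h :: F) -> dual h /\ all_dual F.
Proof.
by move=> d; split=> [|g gF]; apply: d; rewrite inE ?eqxx// gF orbT.
Qed.

Lemma norming_functional (x : X) :
  exists2 h, @dual_ball K X h & h x = `|x|.
Proof.
pose G := [set q : X * K | exists t, q = (t *: x, t * `|x|)].
have [|||f [sf f1 fG]] := scalars_hahn_banach hK (X := X) (G := G).
- by exists (0 *: x, 0 * `|x|), 0.
- move=> t _ _ [a ->] [b ->] /=; exists (t * a + b).
  by rewrite scalerA -scalerDl mulrA -mulrDl.
- by move=> _ [t ->] /=; rewrite normrM normr_id normrZ.
exists f; first exact/(dual_ballP hK).
by rewrite (fG (x, `|x|))//; exists 1; rewrite scale1r mul1r.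
Qed.

(** The values of finitely many functionals map the unit ball onto a bounded, hence
    totally bounded, set. *)
Lemma ball_functional_net F eta : all_dual F -> 0 < eta ->
  exists2 S : seq X, forall s, s \in S -> `|s| <= 1 &
    forall x, `|x| <= 1 ->
      exists2 s, s \in S & forall h, h \in F -> `|h x - h s| <= eta.
Proof.
elim: F eta => [|h F IH] eta.
  move=> _ _; exists [:: 0] => [s|x _]; first by rewrite inE => /eqP ->; rewrite normr0.
  by exists 0; rewrite ?mem_head// => h; rewrite in_nil.
move=> /all_dual_cons[dh dF] eta0.
have eta20 : 0 < eta / 2 by rewrite divr_gt0.
have [S S1 hS] := IH _ dF eta20.
have [M M0 hM] := dual_bounded dh.
have [cs hcs] := scalars_finite_net hK M eta20.
pose W c s x := [/\ `|x| <= 1, `|h x - c| <= eta / 2 &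
  forall g, g \in F -> `|g x - g s| <= eta / 2].
pose w c s := xget 0 (W c s).
exists [seq w c s | c <- cs, s <- S].
  move=> _ /allpairsP[[c s] [_ _ ->]] /=; rewrite /w.
  by case: xgetP => [x _ []|_] //; rewrite normr0.
move=> x x1; have [s sS xs] := hS x x1.
have [|c cS xc] := hcs (h x); first by rewrite (le_trans (hM x))// ler_piMr.
have [w1 wc ws] : W c s (w c s).
  by apply: (@xgetPex _ 0); exists x; split => //; exact: ltW.
exists (w c s); first by apply/allpairsP; exists (c, s).
move=> g; rewrite inE => /predU1P[->|gF].
  rewrite -(subrKA c) (le_trans (ler_normD _ _))// (splitr eta) lerD//.
    exact: ltW.
  by rewrite distrC.
rewrite -(subrKA (g s)) (le_trans (ler_normD _ _))// (splitr eta) lerD//.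
  exact: xs.
by rewrite distrC; exact: ws.
Qed.

(** A bounded lifting for the quotient by the common kernel of F: x is corrected by
    c in a fixed finite-dimensional space, and c is small when the values of F at
    x are small. *)
Lemma annihilator_complement F : all_dual F ->
  exists (us : seq X) (M : K), 0 <= M /\ forall x, exists a : nat -> K,
    let c := \sum_(0 <= i < size us) a i *: us`_i in
    annihilator F (x - c) /\
    forall t, 0 <= t -> (forall h, h \in F -> `|h x| <= t) -> `|c| <= M * t.
Proof.
elim: F => [_|h F IH].
  exists [::], 0; split => // x; exists (fun=> 0); rewrite big_nil; split.
    by move=> h; rewrite in_nil.
  by move=> t _ _; rewrite normr0 mul0r.
move=> /all_dual_cons[dh dF]; have sh := dual_scalar dh.
have [us [M [M0 hM]]] := IH dF.
have sF g : g \in F -> scalar g by move=> /dF/dual_scalar.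
have [hann|] := pselect (forall x, annihilator F x -> h x = 0).
  exists us, M; split => // x; have [a [ann cM]] := hM x; exists a; split.
    by move=> g; rewrite inE => /predU1P[->|/ann//]; exact: hann.
  by move=> t t0 ht; apply: cM => // g gF; apply: ht; rewrite inE gF orbT.
move/existsNP => [v /not_implyP[annv /eqP hv]].
pose u := (h v)^-1 *: v.
have hu : h u = 1 by rewrite scalarZ// mulVf.
have annu : annihilator F u by move=> g gF; rewrite (scalarZ _ _ (sF _ gF)) (annv _ gF) mulr0.
have [N N0 hN] := dual_bounded dh.
exists (u :: us), (M + (1 + N * M) * `|u|); split.
  by rewrite addr_ge0// mulr_ge0// addr_ge0// mulr_ge0.
move=> x; have [a] := hM x; set c := \sum_(_ <= _ < _) _ => -[ann cM].
exists (fun i => if i is j.+1 then a j else h (x - c)).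
rewrite /= big_nat_recl//= -/c; split.
  move=> g; rewrite inE => /predU1P[->|gF].
    by rewrite (scalarB _ _ sh) (scalarD _ _ sh) (scalarZ _ _ sh) hu mulr1 (scalarB _ _ sh); ring.
  have sg := sF _ gF.
  rewrite -(ann _ gF) (scalarB _ _ sg) (scalarD _ _ sg) (scalarZ _ _ sg) (annu _ gF).
  by rewrite mulr0 add0r (scalarB _ _ sg).
move=> t t0 ht; rewrite addrC (le_trans (ler_normD _ _))// mulrDl lerD//.
  by apply: cM => // g gF; apply: ht; rewrite inE gF orbT.
rewrite normrZ mulrAC ler_wpM2r// (scalarB _ _ sh) (le_trans (ler_normB _ _))//.
rewrite mulrDl mul1r lerD//; first by apply: ht; rewrite mem_head.
rewrite (le_trans (hN _))// -mulrA ler_wpM2l//.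
by apply: cM => // g gF; apply: ht; rewrite inE gF orbT.
Qed.

Lemma annihilator_nonzero F : infinite_dimensional X -> all_dual F ->
  exists2 w, annihilator F w & w != 0.
Proof.
move=> infX dF; have [us [M [_ hM]]] := annihilator_complement dF.
apply: contrapT => h; apply: infX; exists (size us), (fun i => us`_i) => x.
have [a [ann _]] := hM x; exists (fun i => a i); rewrite -(big_mkord predT (fun i => a i *: us`_i)).
apply/eqP; rewrite -subr_eq0; apply: contrapT => /negP w0.
by apply: h; eexists; first exact: ann.
Qed.

(** Two points g, k of C near f differ by more than eps at some x in the unit ball.
    Replace x by w = x - s - c, where s is a point of a finite net on which g and k
    are both close to f, and c is a small correction putting w in the common
    kernel of F.  The difference at w is at least eps / 2, the norm of w at
    most 3. *)
Lemma szlenk_derivative_annihilator eps C f F (V : set {ptws X -> K}) :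
  0 < eps -> C `<=` @dual_ball K X -> all_dual F ->
  szlenk_derivative eps C f -> nbhs (f : {ptws X -> K}) V ->
  exists g k w, [/\ (V `&` C) g, (V `&` C) k, annihilator F w, `|w| <= 1 &
    eps / 6 < `|g w - k w|].
Proof.
move=> eps0 CB dF fC Vf.
have [us [M [M0 hM]]] := annihilator_complement dF.
have M1 : 0 < 1 + M by rewrite (lt_le_trans ltr01)// lerDl.
(* Net error 2 eta and correction error 2 M eta then add up to eps / 2. *)
pose eta := eps / (4 * (1 + M)).
have eta0 : 0 < eta by rewrite divr_gt0// mulr_gt0.
have [S S1 hS] := ball_functional_net dF eta0.
have : nbhs (f : {ptws X -> K}) (V `&` [set g | forall s, s \in S -> `|f s - g s| < eta]).
  apply: filterI => //; apply: nbhs_all_seq => s _.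
  have : nbhs (f s) (ball (f s) eta) by exact: nbhsx_ballx.
  by move/(@eval_continuous K X s f); rewrite -ball_normE.
rewrite nbhsE => -[V' [oV' V'f] V'V].
have Cd : C `<=` @dual K X by move=> g /CB [].
have [_ /(_ _ oV' V'f)] := (szlenk_derivativeP eps f Cd).1 fC.
case/(diam_gtP hK) => [g [_ /Cd//]|g [k [x [[V'g Cg] [V'k Ck] x1 gk]]]].
have [Vg gS] := V'V _ V'g; have [Vk kS] := V'V _ V'k.
have /(dual_ballP hK)[sg g1] := CB _ Cg; have /(dual_ballP hK)[sk k1] := CB _ Ck.
have gkle y : `|g y - k y| <= 2 * `|y|.
  by rewrite (le_trans (ler_normB _ _))// mulr_natl mulr2n lerD.
have [s sS xs] := hS x x1.
have [a] := hM (x - s); set c := \sum_(_ <= _ < _) _ => -[ann cM].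
have cMeta : `|c| <= M * eta.
  apply: cM; first exact: ltW.
  by move=> h hF; rewrite (scalarB _ _ (dual_scalar (dF _ hF))) xs.
pose w := x - s - c.
(* The dual ball has diameter at most 2, so the correction has norm at most 1. *)
have eps2 : eps <= 2.
  by rewrite ltW// (lt_le_trans gk)// (le_trans (gkle _))// ler_piMr.
have etaM : eta + M * eta = eps / 4.
  by rewrite /eta; field; rewrite gt_eqF.
have c1 : `|c| <= 1.
  rewrite (le_trans cMeta)// (le_trans (y := eps / 4))//.
    by rewrite -etaM lerDr ltW.
  by rewrite ler_pdivrMr// mul1r (le_trans eps2)// ler_nat.
have w3 : `|w| <= 3.
  rewrite /w (le_trans (ler_normB _ _))// [3](_ : _ = 1 + 1 + 1); last by ring.
  by rewrite lerD// (le_trans (ler_normB _ _))// lerD// S1.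
have gks : `|g s - k s| <= eta + eta.
  rewrite -(subrKA (f s)) (le_trans (ler_normD _ _))// lerD//.
    by rewrite distrC ltW// gS.
  by rewrite ltW// kS.
have gkw : eps / 2 < `|g w - k w|.
  have -> : g w - k w = (g x - k x) - ((g s - k s) + (g c - k c)).
    by rewrite /w !(scalarB _ _ sg) !(scalarB _ _ sk); ring.
  apply: lt_le_trans (lerB_dist _ _).
  have h : `|g s - k s + (g c - k c)| <= eps / 2.
    rewrite (le_trans (ler_normD _ _))//.
    have -> : eps / 2 = (eta + eta) + 2 * (M * eta).
      by transitivity (2 * (eta + M * eta)); [rewrite etaM; field|ring].
    by rewrite lerD// (le_trans (gkle _))// ler_pM2l.
  by rewrite [X in X < _](_ : _ = eps - eps / 2) ?ltr_leB//; field.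
exists g, k, (3^-1 *: w); split => //.
- by move=> h hF; rewrite (scalarZ _ _ (dual_scalar (dF _ hF))) (ann _ hF) mulr0.
- by rewrite normrZ normfV (@ger0_norm _ 3)// ler_pdivrMl// mulr1.
- rewrite (scalarZ _ _ sg) (scalarZ _ _ sk) -mulrBr normrM normfV (@ger0_norm _ 3)//.
  by rewrite [X in X < _](_ : _ = 3^-1 * (eps / 2)) ?ltr_pM2l ?invr_gt0//; field.
Qed.

Section mazur.
Variables (n : nat) (y : nat -> X) (ystar : nat -> X -> K) (delta : K).
Hypothesis ystar_dual : forall i, (i < n)%N -> dual (ystar i).
Hypothesis biorthogonal : forall i j, (i < n)%N -> (j < n)%N ->
  ystar i (y j) = (i == j)%:R.
Hypothesis delta_gt0 : 0 < delta.

(** The functionals norm the points of a finite net of the unit sphere of the span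
    of y_0, ..., y_(n-1).  The net is obtained by projecting a finite net for the
    values of the coordinate functionals on the unit ball of X. *)
Lemma mazur_annihilator : exists2 G, all_dual G &
  forall a w, annihilator G w ->
    `|\sum_(0 <= i < n) a i *: y i| <=
      (1 + delta) * `|\sum_(0 <= i < n) a i *: y i + w|.
Proof.
have d1 : 0 < 1 + delta by rewrite addr_gt0.
(* theta solves (1 + delta) * (1 - 2 * theta) = 1. *)
pose theta := delta / (2 * (1 + delta)).
have theta0 : 0 < theta by rewrite divr_gt0// mulr_gt0.
pose m := 1 + \sum_(0 <= i < n) `|y i|.
have m0 : 0 < m by rewrite (lt_le_trans ltr01)// lerDl sumr_ge0.
have eta0 : 0 < theta / m by rewrite divr_gt0.
pose F := [seq ystar i | i <- iota 0 n].
have dF : all_dual F.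
  by move=> _ /mapP[i +->]; rewrite mem_iota => /andP[_]; exact: ystar_dual.
have [S S1 hS] := ball_functional_net dF eta0.
pose e s := \sum_(0 <= i < n) ystar i s *: y i.
have /choice[h hP] s : exists h, @dual_ball K X h /\ h (e s) = `|e s|.
  by have [h ? ?] := norming_functional (e s); exists h.
exists [seq h s | s <- S].
  by move=> _ /mapP[s _ ->]; have [[]] := hP s.
have unit_case a w : let x := \sum_(0 <= i < n) a i *: y i in
    `|x| = 1 -> annihilator [seq h s | s <- S] w -> 1 <= (1 + delta) * `|x + w|.
  move=> x x1 wann.
  have [|s sS xs] := hS x; first by rewrite x1.
  have [/(dual_ballP hK)[sh h1] hes] := hP s.
  have ex : e x = x.
    apply: eq_big_nat => i /andP[_ ilt]; congr (_ *: _).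
    have si := dual_scalar (ystar_dual ilt).
    rewrite (scalar_sum _ _ _ si).
    rewrite (big_cat_nat (n := i)) ?(ltnW ilt)//= (big_ltn ilt) !big_nat.
    rewrite !big1 => [|j /andP[ij jn]|j /andP[_ ji]].
    - by rewrite addr0 add0r (scalarZ _ _ si) biorthogonal ?eqxx ?mulr1.
    - by rewrite (scalarZ _ _ si) biorthogonal ?(ltn_eqF ij) ?mulr0.
    - by rewrite (scalarZ _ _ si) biorthogonal ?(ltn_trans ji) ?(gtn_eqF ji) ?mulr0.
  have xes : `|x - e s| <= theta.
    rewrite -{1}ex /e -sumrB (le_trans (ler_norm_sum _ _ _))//.
    have le_theta : \sum_(0 <= i < n) theta / m * `|y i| <= theta.
      rewrite -mulr_sumr mulrAC ler_pdivrMr// ler_pM2l// /m lerDr//.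
    rewrite (le_trans _ le_theta)// !big_nat ler_sum// => i /andP[_ ilt].
    rewrite -scalerBl normrZ ler_wpM2r// xs//.
    by apply/mapP; exists i => //; rewrite mem_iota.
  have hw : h s w = 0 by apply: wann; apply/mapP; exists s.
  have e1 : 1 - theta <= `|e s|.
    by rewrite lerBlDr -x1 -{1}(subrK (e s) x) addrC (le_trans (ler_normD _ _))// lerD2l.
  have : 1 - theta - theta <= `|x + w|.
    apply: le_trans (h1 _); rewrite (scalarD _ _ sh) hw addr0.
    have -> : h s x = h s (e s) - h s (e s - x) by rewrite (scalarB _ _ sh); ring.
    apply: le_trans (lerB_dist _ _); rewrite lerB//.
      by rewrite hes ger0_norm.
    by rewrite (le_trans (h1 _))// distrC.
  move=> le_xw; rewrite -(ler_pM2l d1) in le_xw; apply: le_trans le_xw.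
  by rewrite le_eqVlt; apply/orP; left; apply/eqP; rewrite /theta; field; rewrite gt_eqF.
move=> a w wann; set x := \sum_(_ <= _ < _) _.
have [->|x0] := eqVneq x 0; first by rewrite normr0 mulr_ge0// ltW.
have nx0 : 0 < `|x| by rewrite normr_gt0.
have := unit_case (fun i => `|x|^-1 * a i) (`|x|^-1 *: w).
under eq_bigr do rewrite -scalerA.
rewrite /= -scaler_sumr -/x normrZ normfV normr_id mulVf ?gt_eqF// => /(_ erefl).
rewrite -scalerDr normrZ normfV normr_id.
rewrite mulrCA -ler_pdivrMl ?invr_gt0// invrK mulr1; apply.
move=> g gS; have [s _ gs] := mapP gS.
have [[dg _] _] := hP s; rewrite -gs in dg.
by rewrite (scalarZ _ _ (dual_scalar dg)) (wann _ gS) mulr0.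
Qed.

End mazur.
End annihilator.

(** * Inductive choice of the basic sequence *)

Lemma prefix_dependent_choice (T : Type) (t0 : T) (P : seq T -> T -> Prop) :
  (forall s, (forall i, (i < size s)%N -> P (take i s) (nth t0 s i)) ->
    exists t, P s t) ->
  exists u : nat -> T, forall n, P (mkseq u n) (u n).
Proof.
move=> hP.
have /choice[next nextP] s : exists t,
    (forall i, (i < size s)%N -> P (take i s) (nth t0 s i)) -> P s t.
  have [/hP[t Pt]|h] := pselect (forall i, (i < size s)%N -> P (take i s) (nth t0 s i)).
    by exists t.
  by exists t0.
pose pre n := iter n (fun s => rcons s (next s)) [::].
pose u n := next (pre n).
have preE n : pre n = mkseq u n.
  by elim: n => // n IH; rewrite mkseqS -IH.
exists u => n; rewrite -preE; elim/ltn_ind: n => n IH.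
apply: nextP => i; rewrite preE size_mkseq => ilt.
by rewrite /mkseq -map_take take_iota (minn_idPl (ltnW ilt)) nth_mkseq// -/(mkseq u i) -preE; exact: IH.
Qed.

Section construction.
Context {K : numFieldType} {X : normedModType K}.
Hypothesis hK : complete_scalars K.
Hypothesis infX : infinite_dimensional X.

(** Take a functional that norms y_n and correct its values at the earlier y_i by a
    combination of their coordinate functionals, which vanish at y_n. *)
Lemma coordinate_functional n (y : nat -> X) (ystar : nat -> X -> K) :
  (forall i, (i < n)%N -> dual (ystar i)) ->
  (forall i j, (i < n)%N -> (j < n)%N -> ystar i (y j) = (i == j)%:R) ->
  (forall i, (i < n)%N -> ystar i (y n) = 0) -> y n != 0 ->
  exists2 h, dual h & forall j, (j <= n)%N -> h (y j) = (n == j)%:R.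
Proof.
move=> dy bio yn yn0; have [h [dh _] hy] := norming_functional hK (y n).
have nyn0 : `|y n| != 0 by rewrite normr_eq0.
pose b i := - (h (y i) / `|y n|).
exists (fun x => `|y n|^-1 * h x + \sum_(0 <= i < n | (i < n)%N) b i * ystar i x).
  apply: dual_lin => //; exact: dual_sum.
move=> j; rewrite leq_eqVlt => /predU1P[->|jn].
  rewrite eqxx hy mulVf//; rewrite big1 ?addr0// => i ilt.
  by rewrite yn// mulr0.
rewrite (gtn_eqF jn) (big_cat_nat (n := j)) ?(ltnW jn)//=.
rewrite [X in _ + (_ + X)]big_ltn_cond// jn.
rewrite [X in _ + (X + _)]big_nat_cond [X in _ + (_ + (_ + X))]big_nat_cond.
rewrite !big1 => [|i /andP[/andP[ji _] ilt]|i /andP[/andP[_ ij] ilt]].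
- by rewrite addr0 add0r bio// eqxx mulr1 /b mulrC subrr.
- by rewrite bio// (gtn_eqF ji) mulr0.
- by rewrite bio// (ltn_eqF ij) mulr0.
Qed.

Variables (delta : K) (C : nat -> set (X -> K)) (eps : nat -> K).
Variables (c : nat -> seq K) (r : nat -> K).
Hypothesis delta_gt0 : 0 < delta.
Hypothesis C_ball : forall n, C n `<=` @dual_ball K X.
Hypothesis eps_gt0 : forall n, 0 < eps n.

(** Only the first n vectors count: they are the ones known when y_n is chosen. *)
Definition box n (y : nat -> X) : set (X -> K) :=
  [set g | forall j, (j < n)%N -> (j < size (c n))%N -> `|g (y j) - (c n)`_j| < r n].

Lemma box_nbhs n y f : box n y f -> nbhs (f : {ptws X -> K}) (box n y).
Proof.
move=> bf.
pose s := [seq j <- iota 0 n | (j < size (c n))%N].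
have sE j : (j \in s) = (j < n)%N && (j < size (c n))%N.
  by rewrite mem_filter mem_iota andbC.
rewrite (_ : box n y = [set g | forall j, j \in s -> ball (c n)`_j (r n) (g (y j))]).
  apply: nbhs_all_seq => j; rewrite sE => /andP[jn js].
  apply: (@eval_continuous K X (y j) f); apply: open_nbhs_nbhs; split.
    exact: ball_open.
  by rewrite -ball_normE /= distrC; exact: bf.
apply/seteqP; split => g bg j.
  by rewrite sE => /andP[jn js]; rewrite -ball_normE /= distrC; exact: bg.
by move=> jn js; have := bg j; rewrite sE jn js -ball_normE /= distrC; exact.
Qed.

(** What the n-th stage has to achieve.  The lists [G j] with j <= n constrain y_n;
    [stage_dense] serves to make the basis shrinking and [stage_far] to keep
    the Szlenk index large. *)
Record stage_spec n (y : nat -> X) (ystar : nat -> X -> K) (G : nat -> seq (X -> K)) : Prop :=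
  StageSpec {
  stage_dual : dual (ystar n);
  stage_all_dual : all_dual (G n);
  stage_biorthogonal : forall j, (j <= n)%N -> ystar n (y j) = (n == j)%:R;
  stage_ystar : forall j, (j < n)%N -> ystar j (y n) = 0;
  stage_annihilator : forall j, (j <= n)%N -> annihilator (G j) (y n);
  stage_ball : `|y n| <= 1;
  stage_mazur : forall a w, annihilator (G n) w ->
    `|\sum_(0 <= i < n) a i *: y i| <=
      (1 + delta) * `|\sum_(0 <= i < n) a i *: y i + w|;
  stage_dense : C n `&` box n y !=set0 ->
    exists2 f, f \in G n & (C n `&` box n y) f;
  stage_far : szlenk_derivative (eps n) (C n) `&` box n y !=set0 ->
    exists g k, [/\ (C n `&` box n y) g, (C n `&` box n y) k &
      eps n / 6 < `|g (y n) - k (y n)|] }.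

(** The n-th stage looks only at the first n + 1 entries, so the sequence can be
    built by recursion on finite prefixes. *)
Lemma stage_spec_ext n y y' ystar ystar' G G' :
  (forall i, (i <= n)%N -> [/\ y i = y' i, ystar i = ystar' i & G i = G' i]) ->
  stage_spec n y ystar G -> stage_spec n y' ystar' G'.
Proof.
move=> e [h1 h2 h3 h4 h5 h6 h7 h8 h9].
have ey i : (i <= n)%N -> y i = y' i by case/e.
have es i : (i <= n)%N -> ystar i = ystar' i by case/e.
have eG i : (i <= n)%N -> G i = G' i by case/e.
have eb : box n y = box n y'.
  by apply/seteqP; split => g h j jn; [rewrite -ey ?(ltnW jn)//|rewrite ey ?(ltnW jn)//]; exact: h.
have esum a : \sum_(0 <= i < n) a i *: y i = \sum_(0 <= i < n) a i *: y' i.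
  by apply: eq_big_nat => i /andP[_ /ltnW/ey ->].
split.
- by rewrite -es.
- by rewrite -eG.
- by move=> j jn; rewrite -es// -ey// h3.
- by move=> j jn; rewrite -es ?(ltnW jn)// -ey// h4.
- by move=> j jn; rewrite -eG// -ey//; exact: h5.
- by rewrite -ey.
- by move=> a w; rewrite -eG// -esum; exact: h7.
- by rewrite -eb -eG.
- by rewrite -eb -ey.
Qed.

(** The functionals are chosen first (Mazur's and a point of the level in the box),
    then y_n in the kernel of all functionals met so far, then the coordinate
    functional of y_n. *)
Lemma stage_exists n y ystar G : (forall i, (i < n)%N -> stage_spec i y ystar G) ->
  exists yn ystarn Gn, stage_spec n
    (fun i => if i == n then yn else y i)
    (fun i => if i == n then ystarn else ystar i)
    (fun i => if i == n then Gn else G i).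
Proof.
move=> h.
have dy i : (i < n)%N -> dual (ystar i) by move=> /h[].
have bio i j : (i < n)%N -> (j < n)%N -> ystar i (y j) = (i == j)%:R.
  move=> ilt jlt; have [ij|ji] := leqP j i; first by have [_ _ ->] := h _ ilt.
  by rewrite (ltn_eqF ji); have [_ _ _ ->] := h _ jlt.
have [G1 dG1 mazur] := mazur_annihilator hK dy bio delta_gt0.
have [G2 [dG2 denseG]] : exists G2, all_dual G2 /\ (C n `&` box n y !=set0 ->
    exists2 f, f \in G2 & (C n `&` box n y) f).
  have [[f Cf]|nC] := pselect (C n `&` box n y !=set0); last first.
    by exists [::]; split.
  exists [:: f]; split; last by exists f; rewrite ?mem_head.
  by move=> g; rewrite inE => /eqP ->; case: Cf => /C_ball[].
pose F := G1 ++ G2 ++ [seq ystar i | i <- iota 0 n] ++ flatten [seq G i | i <- iota 0 n].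
have dF : all_dual F.
  move=> g; rewrite !mem_cat => /or4P[/dG1|/dG2|/mapP[i +->]|/flattenP[_ /mapP[i + ->]]]//.
    by rewrite mem_iota => /andP[_]; exact: dy.
  by rewrite mem_iota => /andP[_ /h/stage_all_dual dGi] /dGi.
have [yn [annyn yn0 yn1 far]] : exists yn, [/\ annihilator F yn, yn != 0, `|yn| <= 1 &
    szlenk_derivative (eps n) (C n) `&` box n y !=set0 ->
    exists g k, [/\ (C n `&` box n y) g, (C n `&` box n y) k &
      eps n / 6 < `|g yn - k yn|]].
  have [[f [sf bf]]|nf] := pselect (szlenk_derivative (eps n) (C n) `&` box n y !=set0).
    have [g [k [w [[bg Cg] [bk Ck] annw w1 far]]]] :=
      szlenk_derivative_annihilator hK (eps_gt0 n) (@C_ball n) dF sf (box_nbhs bf).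
    exists w; split => //; last by move=> _; exists g, k.
    have [[/dual_scalar sg _] [/dual_scalar sk _]] := (C_ball Cg, C_ball Ck).
    apply/eqP => w0; move: far; rewrite w0 (scalar0 sg) (scalar0 sk) subrr normr0.
    have e6 : 0 < eps n / 6 by rewrite divr_gt0.
    by move/(lt_trans e6); rewrite ltxx.
  have [w annw w0] := annihilator_nonzero infX dF.
  exists (`|w|^-1 *: w); split => //.
  - by move=> g gF; rewrite (scalarZ _ _ (dual_scalar (dF _ gF))) (annw _ gF) mulr0.
  - by rewrite scaler_eq0 invr_eq0 normr_eq0 (negbTE w0).
  - by rewrite normrZ normfV normr_id mulVf// normr_eq0.
have ystaryn i : (i < n)%N -> ystar i yn = 0.
  move=> ilt; apply: annyn; rewrite !mem_cat; apply/or4P; apply: Or43.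
  by apply/mapP; exists i => //; rewrite mem_iota.
have [|||ystarn dystarn ystarnE] := @coordinate_functional n
    (fun i => if i == n then yn else y i) ystar dy.
- by move=> i j ilt jlt; rewrite (ltn_eqF jlt) bio.
- by move=> i ilt; rewrite eqxx ystaryn.
- by rewrite eqxx.
exists yn, ystarn, (G1 ++ G2).
have eb : box n (fun i => if i == n then yn else y i) = box n y.
  by apply/seteqP; split => g hg j jn; have := hg j jn; rewrite (ltn_eqF jn).
have esum a : \sum_(0 <= i < n) a i *: (if i == n then yn else y i) =
    \sum_(0 <= i < n) a i *: y i.
  by apply: eq_big_nat => i /andP[_ ilt]; rewrite (ltn_eqF ilt).
split; rewrite ?eqxx//.
- by move=> g; rewrite mem_cat => /orP[/dG1|/dG2].
- by move=> j jn; rewrite (ltn_eqF jn) ystaryn.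
- move=> j; rewrite leq_eqVlt => /predU1P[->|jn].
    by rewrite eqxx => g gG; apply: annyn; move: gG; rewrite !mem_cat => /orP[->|->]; rewrite ?orbT.
  rewrite (ltn_eqF jn) => g gG; apply: annyn; rewrite !mem_cat; apply/or4P; apply: Or44.
  by apply/flattenP; exists (G j) => //; apply/mapP; exists j => //; rewrite mem_iota.
- by move=> a w annw; rewrite esum; apply: mazur => g gG; apply: annw; rewrite mem_cat gG.
- by rewrite eb => /denseG[f fG Cf]; exists f => //; rewrite mem_cat fG orbT.
- by rewrite eb.
Qed.

Lemma stages_exist : exists y ystar G, forall n, stage_spec n y ystar G.
Proof.
pose T := (X * (X -> K) * seq (X -> K))%type.
pose t0 : T := (0, fun=> 0, [::]).
pose spec n (u : nat -> T) :=
  stage_spec n (fun i => (u i).1.1) (fun i => (u i).1.2) (fun i => (u i).2).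
have spec_ext n u v : (forall i, (i <= n)%N -> u i = v i) -> spec n u -> spec n v.
  by move=> uv; apply: stage_spec_ext => i /uv ->.
have [s hs|u hu] := @prefix_dependent_choice T t0
    (fun s t => spec (size s) (nth t0 (rcons s t))).
  have [|yn [ystarn [Gn h]]] := @stage_exists (size s) (fun i => (nth t0 s i).1.1)
    (fun i => (nth t0 s i).1.2) (fun i => (nth t0 s i).2).
    move=> i ilt; have := hs _ ilt; rewrite size_take ilt.
    apply: spec_ext => j ji; rewrite -take_nth// nth_take//.
  exists (yn, ystarn, Gn); apply: stage_spec_ext h => i.
  by rewrite nth_rcons; case: ltngtP.
exists (fun i => (u i).1.1), (fun i => (u i).1.2), (fun i => (u i).2) => n.
have := hu n; rewrite size_mkseq; apply: spec_ext => i ilt.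
rewrite nth_rcons size_mkseq; move: ilt; rewrite leq_eqVlt => /predU1P[->|ilt].
  by rewrite ltnn eqxx.
by rewrite ilt nth_mkseq.
Qed.

End construction.

(** * Closed spans of biorthogonal sequences with bounded partial sums *)

Section closed_span.
Context {K : numFieldType} {X : normedModType K} (y : nat -> X).

(** The norm closure of the linear span, written out with finite sums so that no
    closure operator has to be unfolded. *)
Definition closed_span : {pred X} := fun x => `[< forall e, 0 < e ->
  exists n a, `|x - \sum_(0 <= i < n) a i *: y i| < e >].

Lemma closed_spanP x : reflect (forall e, 0 < e ->
  exists n a, `|x - \sum_(0 <= i < n) a i *: y i| < e) (x \in closed_span).
Proof. exact: asboolP. Qed.

Lemma closed_span_submod : GRing.submod_closed closed_span.
Proof.
split.
  apply/closed_spanP => e e0; exists 0%N, (fun=> 0).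
  by rewrite big_nil subr0 normr0.
move=> t u v /closed_spanP hu /closed_spanP hv; apply/closed_spanP => e e0.
have t1 : 0 < `|t| + 1 by rewrite ltr_wpDl.
have e2 : 0 < e / 2 by rewrite divr_gt0.
have et : 0 < e / 2 / (`|t| + 1) by rewrite divr_gt0.
have [n [a ua]] := hu _ et; have [m [b vb]] := hv _ e2.
(* Extend both coefficient sequences by 0 to sums of equal length. *)
pose cut k (d : nat -> K) i := if (i < k)%N then d i else 0.
have cutE k l d : (k <= l)%N ->
    \sum_(0 <= i < l) cut k d i *: y i = \sum_(0 <= i < k) d i *: y i.
  move=> kl; rewrite (big_cat_nat (n := k))//= [X in _ + X]big_nat [X in _ + X]big1 ?addr0.
    by apply: eq_big_nat => i /andP[_ ik]; rewrite /cut ik.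
  by move=> i /andP[ki _]; rewrite /cut ltnNge ki scale0r.
exists (maxn n m), (fun i => t * cut n a i + cut m b i).
under eq_bigr do rewrite scalerDl -scalerA.
rewrite big_split /= -scaler_sumr !cutE ?leq_maxl ?leq_maxr//.
rewrite opprD addrACA -scalerBr (le_lt_trans (ler_normD _ _))// (splitr e) ler_ltD//.
rewrite normrZ (le_trans (y := (`|t| + 1) * (e / 2 / (`|t| + 1))))//.
  rewrite ler_pM//; first by rewrite lerDl.
  exact: ltW.
by rewrite mulrC divfK// gt_eqF.
Qed.

HB.instance Definition _ := GRing.isSubmodClosed.Build K X closed_span
  (GRing.submod_closed_semi closed_span_submod).

Definition span_subspace : submodClosed X := closed_span.

Lemma span_subspace_closed : closed [set x | x \in span_subspace].
Proof.
move=> x clx; apply/closed_spanP => e e0.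
have e2 : 0 < e / 2 by rewrite divr_gt0.
have [z [/= /closed_spanP/(_ _ e2)[n [a za]]]] := clx _ (nbhsx_ballx x _ e2).
rewrite -ball_normE /= => xz; exists n, a.
by rewrite -(subrKA z) (le_lt_trans (ler_normD _ _))// (splitr e) ltrD.
Qed.

Lemma span_subspace_gen n : y n \in span_subspace.
Proof.
apply/closed_spanP => e e0; exists n.+1, (fun i => (i == n)%:R).
rewrite big_nat_recr//= eqxx scale1r big_nat big1 ?add0r ?subrr ?normr0//.
by move=> i /andP[_ /ltn_eqF ->]; rewrite scale0r.
Qed.

End closed_span.

Section basis.
Context {K : numFieldType} {X : normedModType K}.
Hypothesis hK : complete_scalars K.
Variables (y : nat -> X) (ystar : nat -> X -> K) (delta : K).
Hypothesis ystar_dual : forall i, dual (ystar i).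
Hypothesis biorthogonal : forall i j, ystar i (y j) = (i == j)%:R.
Hypothesis delta_gt0 : 0 < delta.
Hypothesis projection_bound : forall n N a, (n <= N)%N ->
  `|\sum_(0 <= i < n) a i *: y i| <=
    (1 + delta) * `|\sum_(0 <= i < N) a i *: y i|.

Local Notation Y := (span_subspace y).
Local Notation Z := (subspace_type Y).

Let sy i : scalar (ystar i). Proof. exact: dual_scalar. Qed.

Definition proj_sum N x := \sum_(0 <= i < N) ystar i x *: y i.

Lemma ystar_sum i n a :
  ystar i (\sum_(0 <= j < n) a j *: y j) = if (i < n)%N then a i else 0.
Proof.
rewrite (scalar_sum _ _ _ (sy i)).
under eq_bigr do rewrite (scalarZ _ _ (sy i)) biorthogonal.
case: ifPn => [ilt|nlt].
  rewrite (big_cat_nat (n := i)) ?(ltnW ilt)//= (big_ltn ilt) !big_nat.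
  rewrite !big1 => [|j /andP[ij _]|j /andP[_ ji]].
  - by rewrite eqxx addr0 add0r mulr1.
  - by rewrite (ltn_eqF ij) mulr0.
  - by rewrite (gtn_eqF ji) mulr0.
rewrite big_nat big1// => j /andP[_ jn].
by rewrite gtn_eqF ?mulr0// (leq_trans jn)// leqNgt.
Qed.

Lemma proj_sum_big n N a : (n <= N)%N ->
  proj_sum N (\sum_(0 <= i < n) a i *: y i) = \sum_(0 <= i < n) a i *: y i.
Proof.
move=> nN; rewrite /proj_sum.
under eq_bigr do rewrite ystar_sum.
rewrite (big_cat_nat (n := n))//= [X in _ + X]big_nat [X in _ + X]big1 ?addr0.
  by apply: eq_big_nat => i /andP[_ ->].
by move=> i /andP[ni _]; rewrite ltnNge ni scale0r.
Qed.

Lemma proj_sum_small n N a : (N <= n)%N ->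
  proj_sum N (\sum_(0 <= i < n) a i *: y i) = \sum_(0 <= i < N) a i *: y i.
Proof.
move=> Nn; apply: eq_big_nat => i /andP[_ iN].
by rewrite ystar_sum (leq_trans iN).
Qed.

Lemma proj_sumB N x z : proj_sum N (x - z) = proj_sum N x - proj_sum N z.
Proof.
rewrite /proj_sum -sumrB; apply: eq_bigr => i _.
by rewrite (scalarB _ _ (sy i)) scalerBl.
Qed.

Lemma proj_sum_span_le N n a :
  `|proj_sum N (\sum_(0 <= i < n) a i *: y i)| <=
    (1 + delta) * `|\sum_(0 <= i < n) a i *: y i|.
Proof.
have [Nn|/ltnW nN] := leqP N n.
  by rewrite proj_sum_small//; exact: projection_bound.
by rewrite proj_sum_big// ler_peMl// lerDl ltW.
Qed.

Lemma proj_sum_bounded N : exists2 M, 0 <= M & forall x, `|proj_sum N x| <= M * `|x|.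
Proof.
elim: N => [|N [M M0 hM]].
  by exists 0 => // x; rewrite /proj_sum big_nil normr0 mul0r.
have [A A0 hA] := dual_bounded (ystar_dual N).
exists (M + A * `|y N|); first by rewrite addr_ge0// mulr_ge0.
move=> x; rewrite /proj_sum big_nat_recr//= (le_trans (ler_normD _ _))//.
rewrite mulrDl lerD//; first exact: hM.
by rewrite normrZ mulrAC ler_wpM2r.
Qed.

(** The bound holds on the span, and [proj_sum N] is bounded on the whole space, so
    it passes to the closure. *)
Lemma proj_sum_le N x : x \in Y -> `|proj_sum N x| <= (1 + delta) * `|x|.
Proof.
move=> /closed_spanP xY; apply/ler_addgt0Pr => e e0.
have [M M0 hM] := proj_sum_bounded N.
have d0 : 0 < 1 + delta by rewrite addr_gt0.
have s0 : 0 < M + (1 + delta) by rewrite ltr_wpDl.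
have [n [a]] := xY _ (divr_gt0 e0 s0).
set z := \sum_(_ <= _ < _) _ => xz.
rewrite -(subrK z x) addrC.
have -> : proj_sum N (z + (x - z)) = proj_sum N z + proj_sum N (x - z).
  by rewrite proj_sumB [RHS]addrC subrK; congr (proj_sum N _); rewrite addrC subrK.
rewrite (le_trans (ler_normD _ _))//.
have h1 : `|proj_sum N z| <= (1 + delta) * (`|z + (x - z)| + `|x - z|).
  rewrite (le_trans (proj_sum_span_le _ _ _))// ler_pM2l// -/z.
  by rewrite -{1}(addrK (x - z) z) ler_normB.
rewrite (le_trans (lerD h1 (hM _)))// mulrDr -addrA lerD2l addrC -mulrDl.
by rewrite -ler_pdivlMl// mulrC ltW.
Qed.

(** [proj_sum N] fixes an approximation of x in the span as soon as N is large, and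
    the remaining error is controlled uniformly in N. *)
Lemma proj_sum_approx x e : x \in Y -> 0 < e ->
  exists n, forall N, (n <= N)%N -> `|x - proj_sum N x| <= e.
Proof.
move=> xY e0; have /closed_spanP xY' := xY.
have d0 : 0 < 1 + (1 + delta) by rewrite !addr_gt0.
have [n [a]] := xY' _ (divr_gt0 e0 d0); set z := \sum_(_ <= _ < _) _ => xz.
exists n => N nN.
have zY : z \in Y.
  by apply: rpred_sum => i _; apply: rpredZ; exact: span_subspace_gen.
have -> : x - proj_sum N x = (x - z) - proj_sum N (x - z).
  by rewrite proj_sumB /z (proj_sum_big _ nN) -/z opprB addrA subrK.
rewrite (le_trans (ler_normB _ _))//.
rewrite (le_trans (lerD (lexx _) (proj_sum_le _ (rpredB xY zY))))//.
by rewrite -{1}(mul1r `|x - z|) -mulrDl -ler_pdivlMl// mulrC ltW.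
Qed.

Definition basis_vector n : Z := exist _ (y n) (span_subspace_gen y n).

Lemma val_basis_sum n (a : nat -> K) :
  \val (\sum_(0 <= i < n) a i *: basis_vector i) = \sum_(0 <= i < n) a i *: y i.
Proof.
rewrite raddf_sum; apply: eq_bigr => i _.
by [].
Qed.

Lemma expansion_basis (x : Z) : expansion basis_vector x (fun i => ystar i (\val x)).
Proof.
apply/cvgrPdist_le => e e0.
have [n hn] := proj_sum_approx (valP x) e0.
exists n => // N /= nN; rewrite subspace_normE raddfB /= /series /= val_basis_sum.
exact: hn.
Qed.

Lemma expansion_basis_unique (x : Z) a :
  expansion basis_vector x a -> a = (fun i => ystar i (\val x)).
Proof.
move=> xa; apply/funext => i; apply/eqP; rewrite -subr_eq0 -normr_le0.
apply/ler_addgt0Pr => e e0; rewrite add0r.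
have [M M0 hM] := dual_bounded (ystar_dual i).
have M1 : 0 < M + 1 by rewrite ltr_wpDl.
have /cvgrPdist_le/(_ _ (divr_gt0 e0 M1)) [n _ hn] := xa.
have := hn (maxn n i.+1) (leq_maxl _ _).
rewrite subspace_normE raddfB /= /series /= val_basis_sum => xle.
have -> : a i = ystar i (\sum_(0 <= j < maxn n i.+1) a j *: y j).
  by rewrite ystar_sum leq_max ltnSn orbT.
rewrite distrC -(scalarB _ _ (sy i)) (le_trans (hM _))//.
rewrite (le_trans (ler_wpM2l M0 xle))// mulrCA ger_pMr// ler_pdivrMr// mul1r.
by rewrite lerDl.
Qed.

Lemma coordinateE i (x : Z) : coordinate basis_vector i x = ystar i (\val x).
Proof.
rewrite /coordinate (_ : get _ = (fun i => ystar i (\val x)))//.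
apply: expansion_basis_unique.
apply: (@xgetPex _ point [set a | expansion basis_vector x a]).
by exists (fun i => ystar i (\val x)); exact: expansion_basis.
Qed.

Lemma schauder_basis_vector : schauder_basis basis_vector.
Proof.
move=> x; exists (fun i => ystar i (\val x)); split; first exact: expansion_basis.
by move=> a /expansion_basis_unique.
Qed.

Lemma partial_sumE n (x : Z) : \val (partial_sum basis_vector n x) = proj_sum n (\val x).
Proof.
by rewrite val_basis_sum; apply: eq_bigr => i _; rewrite coordinateE.
Qed.

Lemma basis_constant_vector :
  exists2 b, basis_constant basis_vector b & b <= 1 + delta.
Proof.
pose A := [set r | exists n, exists2 x : Z, `|x| <= 1 &
  r = `|partial_sum basis_vector n x|].
have Ale z : A z -> 0 <= z <= 1 + delta.
  move=> [n [x x1 ->]]; rewrite normr_ge0 subspace_normE partial_sumE.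
  rewrite (le_trans (proj_sum_le _ (valP x)))// ler_piMr//.
  by rewrite addr_ge0// ltW.
have A0 : A !=set0.
  by exists `|partial_sum basis_vector 0 (0 : Z)|, 0%N, 0 => //; rewrite normr0.
have [b hb] := scalars_lub hK A0 Ale.
by exists b => //; apply: hb.2 => z /Ale/andP[].
Qed.

Lemma coordinate_dual i : dual (coordinate basis_vector i).
Proof.
rewrite (_ : coordinate _ _ = restriction (Y := Y) (ystar i)); last first.
  by apply/funext => x; rewrite coordinateE.
exact: restriction_dual.
Qed.

(** The n-th remainder of the expansion of phi is phi composed with the n-th tail
    projection.  A functional that vanishes on all late basis vectors is killed by
    late tail projections, and these are bounded by 2 + delta, so approximability
    of phi by such functionals makes the remainder tend to 0. *)
Lemma shrinking_of_dense_coordinates :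
  (forall phi : Z -> K, dual_ball phi -> forall e : K, 0 < e ->
    exists f n, [/\ dual f, forall m, (n <= m)%N -> f (y m) = 0 &
      forall z : Z, `|z| <= 1 -> `|phi z - f (\val z)| <= e]) ->
  shrinking basis_vector.
Proof.
move=> happ; split; first exact: coordinate_dual.
move=> phi dphi; have sphi := dual_scalar dphi.
pose rem (a : nat -> K) n := fun x => phi x - \sum_(0 <= i < n) a i * coordinate basis_vector i x.
have remE a n : rem a n = (phi \- (fun x => \sum_(0 <= i < n | xpredT i) a i * coordinate basis_vector i x)).
  by [].
have drem a n : dual (rem a n).
  rewrite remE; apply: dual_sub => //; apply: dual_sum => i _; exact: coordinate_dual.
exists (fun i => phi (basis_vector i)); split; last first.
  move=> a ha; apply/funext => i.
  have hai : (rem a n (basis_vector i)) @[n --> \oo] --> (0 : K).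
    apply/cvgrPdist_le => e e0; rewrite /= in ha.
    have b0 : 0 < `|basis_vector i| + 1 by rewrite ltr_wpDl.
    have /cvgrPdist_le/(_ _ (divr_gt0 e0 b0)) := ha.
    apply: filterS => n; rewrite !sub0r !normrN ger0_norm; last by apply: dual_norm_ge0 => //; exact: drem.
    rewrite -/(rem a n) => h; rewrite (le_trans (le_dual_norm hK _ (drem a n)))//.
    rewrite (le_trans (ler_wpM2r (normr_ge0 _) h))// mulrAC -mulrA ger_pMr//.
    by rewrite ler_pdivrMr// mul1r lerDl.
  move: hai => /cvgrPdist_le hai'.
  apply/eqP; rewrite -subr_eq0 -normr_le0; apply/ler_addgt0Pr => e e0; rewrite add0r.
  have [n _ hn] := hai' _ e0; have := hn (maxn n i.+1) (leq_maxl _ _).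
  rewrite sub0r normrN /rem.
  have -> // : \sum_(0 <= j < maxn n i.+1) a j * coordinate basis_vector j (basis_vector i) = a i.
  rewrite -[RHS](_ : ystar i (\sum_(0 <= j < maxn n i.+1) a j *: y j) = _).
    rewrite (scalar_sum _ _ _ (sy i)); apply: eq_bigr => j _.
    by rewrite coordinateE (scalarZ _ _ (sy i)) !biorthogonal eq_sym.
  by rewrite ystar_sum leq_max ltnSn orbT.
set a := fun i => phi (basis_vector i).
have rem_phi n (x : Z) : rem a n x = phi (x - partial_sum basis_vector n x).
  rewrite (scalarB _ _ sphi) (scalar_sum _ _ _ sphi); congr (_ - _).
  by apply: eq_bigr => i _; rewrite (scalarZ _ _ sphi) mulrC.
have [N N0 phiN] := dual_bounded dphi.
have N1 : 0 < N + 1 by rewrite ltr_wpDl.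
have d2 : 0 < 1 + (1 + delta) by rewrite !addr_gt0.
apply/cvgrPdist_le => e e0.
(* Density is assumed for the unit ball, so phi is scaled into it. *)
have psiB : @dual_ball K Z (fun x => (N + 1)^-1 * phi x).
  apply/(dual_ballP hK); split; first by move=> t u v; rewrite sphi; ring.
  move=> x; rewrite normrM normfV (ger0_norm (ltW N1)) ler_pdivrMl//.
  by rewrite (le_trans (phiN x))// ler_wpM2r// lerDl.
have c0 : 0 < e / (1 + (1 + delta)) / (N + 1) by rewrite !divr_gt0.
have [f [n [df f0 fapp]]] := happ _ psiB _ c0.
have sf := dual_scalar df.
exists n => // m /= nm; rewrite sub0r normrN ger0_norm; last by apply: dual_norm_ge0 => //; exact: drem.
rewrite -/(rem a m); apply: dual_norm_le; first exact: hK.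
  exact: drem.
move=> x x1; rewrite rem_phi; set w := x - _.
have fw : f (\val w) = 0.
  apply/eqP; rewrite -normr_le0; apply/ler_addgt0Pr => t t0; rewrite add0r.
  have [M M0 hM] := dual_bounded df.
  have M1 : 0 < M + 1 by rewrite ltr_wpDl.
  have [k hk] := proj_sum_approx (valP x) (divr_gt0 t0 M1).
  have hx := hk (maxn k m) (leq_maxl _ _).
  have -> : f (\val w) = f (\val x - proj_sum (maxn k m) (\val x)).
    rewrite /w raddfB /= partial_sumE !(scalarB _ _ sf); congr (_ - _).
    have tail : f (\sum_(m <= i < maxn k m) ystar i (\val x) *: y i) = 0.
      rewrite (scalar_sum _ _ _ sf) big_nat big1// => i /andP[mi _].
      by rewrite (scalarZ _ _ sf) f0 ?mulr0// (leq_trans nm).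
    rewrite /proj_sum [in RHS](big_cat_nat (n := m)) ?leq_maxr//=.
    by rewrite [RHS](scalarD _ _ sf) [X in _ = _ + X]tail addr0.
  rewrite (le_trans (hM _))// (le_trans (ler_wpM2l M0 hx))// mulrCA ger_pMr//.
  by rewrite ler_pdivrMr// mul1r lerDl.
have wle : `|w| <= 1 + (1 + delta).
  rewrite (le_trans (ler_normB _ _))// lerD//.
  rewrite [X in X <= _]subspace_normE partial_sumE (le_trans (proj_sum_le _ (valP x)))//.
  by rewrite ler_piMr// addr_ge0// ltW.
have [->|w0] := eqVneq w 0; first by rewrite (scalar0 sphi) normr0 ltW.
have nw : 0 < `|w| by rewrite normr_gt0.
have := fapp (`|w|^-1 *: w).
rewrite normrZ normfV normr_id mulVf ?gt_eqF// => /(_ (lexx _)).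
rewrite linearZ /= (scalarZ _ _ sf) fw mulr0 subr0 (scalarZ _ _ sphi).
rewrite mulrCA normrM normfV normr_id ler_pdivrMl// normrM normfV (ger0_norm (ltW N1)).
rewrite ler_pdivrMl// => /le_trans; apply.
set D := 1 + (1 + delta) in wle d2 *; set L := (X in X <= e).
have -> : L = e * `|w| / D by rewrite /L; field; rewrite !gt_eqF.
by rewrite ler_pdivrMr// ler_pM2l.
Qed.

End basis.

(** * The Szlenk levels of the closed span *)

(** Injectivity in the second component: the codes cannot all lie below m. *)
Lemma pickle_unbounded (T : countType) (t : T) (m : nat) :
  exists l : nat, (m <= @pickle (T * nat)%type (t, l))%N.
Proof.
apply: contrapT => h.
pose s := [seq @pickle (T * nat)%type (t, l) | l <- iota 0 m.+1].
have us : uniq s.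
  rewrite map_inj_uniq ?iota_uniq// => a b /(pcan_inj pickleK) [].
  by [].
have : (size s <= size (iota 0 m))%N.
  apply: uniq_leq_size => // _ /mapP[l _ ->]; rewrite mem_iota add0n ltnNge.
  by apply/negP => ml; apply: h; exists l.
by rewrite size_map !size_iota ltnn.
Qed.

Lemma countable_ord_enum (alpha : ord) : (alpha < omega1)%O ->
  exists lv : nat -> ord, forall z, (z < alpha)%O -> exists i, lv i = z.
Proof.
move=> /lt_omega1/countable_injP[g ginj].
exists (fun n => xget ozero [set b | (b < alpha)%O /\ g b = n]) => z za.
exists (g z); have [ba gb] := xgetPex ozero
  (ex_intro [set b | (b < alpha)%O /\ g b = g z] z (conj za erefl)).
by apply: ginj; rewrite ?inE.
Qed.

Section reduction.
Context {K : numFieldType} {X : completeNormedModType K}.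
Hypothesis hK : complete_scalars K.
Variables (alpha : ord) (delta : K).
Hypothesis delta_gt0 : 0 < delta.
Hypothesis level_alpha : forall eps : K, 0 < eps ->
  szlenk_iter eps (@dual_ball K X) alpha = set0.
Variables (lv : nat -> ord) (q : nat -> K).
Hypothesis lv_onto : forall z, (z < alpha)%O -> exists i, lv i = z.
Hypothesis q_dense : forall z e : K, 0 < e -> exists n, `|z - q n| < e.

Local Notation level eps z := (szlenk_iter eps (@dual_ball K X) z).

(** Positive scalars close to each positive eps; the moduli of a dense sequence,
    with 1 in place of a possible 0. *)
Definition grid_radius n : K := if q n == 0 then 1 else `|q n|.

Lemma grid_radius_gt0 n : 0 < grid_radius n.
Proof. by rewrite /grid_radius; case: eqVneq => // qn; rewrite normr_gt0. Qed.

Lemma grid_radius_near (eps : K) : 0 < eps ->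
  exists n, eps / 11 <= grid_radius n <= eps.
Proof.
move=> e0; have e4 : 0 < eps / 4 by rewrite divr_gt0.
have [n hn] := q_dense (eps / 2) e4; exists n.
have e2 : `|eps / 2| = eps / 2 by rewrite ger0_norm// divr_ge0// ltW.
have lo : eps / 4 <= `|q n|.
  have : eps / 2 <= eps / 4 + `|q n|.
    rewrite -{1}e2 -{1}(subrK (q n) (eps / 2)) (le_trans (ler_normD _ _))// lerD2r.
    exact: ltW.
  by rewrite -lerBlDl; apply: le_trans; rewrite le_eqVlt; apply/orP; left; apply/eqP; field.
have hi : `|q n| <= eps.
  rewrite -(subKr (eps / 2) (q n)) (le_trans (ler_normB _ _))// e2.
  rewrite [X in _ <= X](splitr eps) lerD2l (le_trans (ltW hn))//.
  by rewrite ler_pM2l// lef_pV2 ?posrE// ler_nat.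
have qn0 : q n != 0 by rewrite -normr_gt0 (lt_le_trans e4).
rewrite /grid_radius (negbTE qn0) hi andbT (le_trans _ lo)//.
by rewrite ler_pM2l// lef_pV2 ?posrE// ler_nat.
Qed.

(** A request consists of the index of an ordinal, the index of an eps, the indices
    of the centres of a box and the index of a tolerance.  The extra natural number
    that is decoded and dropped makes each request recur at arbitrarily late
    stages, when all vectors that the box refers to are available. *)
Definition request n : nat * nat * seq nat * nat :=
  if @unpickle (nat * nat * seq nat * nat * nat)%type n is Some p then p.1
  else (0, 0, [::], 0)%N.

Lemma request_recurrent p m : exists2 n, (m <= n)%N & request n = p.
Proof.
have [l ml] := @pickle_unbounded (nat * nat * seq nat * nat)%type p m.
by exists (pickle (p, l)) => //; rewrite /request pickleK.
Qed.

Definition request_eps n := grid_radius (request n).1.1.2.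
Definition request_set n := level (request_eps n) (lv (request n).1.1.1).
Definition request_centres n := [seq q i | i <- (request n).1.2].
Definition request_tol n : K := (request n).2.+1%:R^-1.

(** Each f lies in arbitrarily small boxes of the enumeration, paired with any
    prescribed level. *)
Lemma request_box y (f : X -> K) i z m (e : K) : 0 < e -> (z < alpha)%O ->
  exists n, [/\ request_set n = level (grid_radius i) z, request_eps n = grid_radius i,
    box request_centres request_tol n y f &
    forall g, box request_centres request_tol n y g ->
      forall j, (j < m)%N -> `|f (y j) - g (y j)| < e].
Proof.
move=> e0 za; have [a lva] := lv_onto za.
have e2 : 0 < e / 2 by rewrite divr_gt0.
have [k hk] : exists k : nat, (k.+1%:R : K)^-1 < e / 2.
  have ie : 0 <= (e / 2)^-1 by rewrite invr_ge0 ltW.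
  have [k hk] := scalars_archimedean hK ie; exists k.
  rewrite invf_plt ?posrE//; apply: (lt_le_trans hk); by rewrite ler_nat.
have k0 : 0 < (k.+1%:R : K)^-1 by rewrite invr_gt0.
have /choice[cs hcs] j := q_dense (f (y j)) k0.
have [n mn rn] := request_recurrent (a, i, [seq cs j | j <- iota 0 m], k) m.
have cE j : (j < m)%N -> (request_centres n)`_j = q (cs j).
  move=> jm; rewrite /request_centres rn /= (nth_map 0%N) ?size_map ?size_iota//.
  by rewrite (nth_map 0%N) ?size_iota// nth_iota.
have sE : size (request_centres n) = m by rewrite /request_centres rn /= !size_map size_iota.
exists n; split.
- by rewrite /request_set /request_eps rn /= lva.
- by rewrite /request_eps rn.
- by move=> j _; rewrite sE => jm; rewrite cE// /request_tol rn /=; exact: hcs.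
- move=> g bg j jm; have := bg j (leq_trans jm mn); rewrite sE cE// => /(_ jm).
  rewrite /request_tol rn /= => gj.
  rewrite -(subrKA (q (cs j))) (le_lt_trans (ler_normD _ _))// (splitr e) ltrD//.
    exact: lt_trans (hcs j) hk.
  by rewrite distrC (lt_trans gj).
Qed.

Variables (y : nat -> X) (ystar : nat -> X -> K) (G : nat -> seq (X -> K)).
Hypothesis stages : forall n, stage_spec delta request_set request_eps
  request_centres request_tol n y ystar G.

Local Notation Y := (span_subspace y).
Local Notation Z := (subspace_type Y).
Local Notation b := (basis_vector y).
Local Notation levelY eps z := (szlenk_iter eps (@dual_ball K Z) z).

(** On the bounded set [dual_ball] pointwise closeness at finitely many points of Z
    follows from closeness at finitely many basis vectors, because these span a
    dense subspace. *)
Lemma ball_nbhs_basis (phi : Z -> K) (V : set {ptws Z -> K}) :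
  dual_ball phi -> nbhs (phi : {ptws Z -> K}) V ->
  exists m, exists2 e : K, 0 < e & forall g, @dual_ball K Z g ->
    (forall j, (j < m)%N -> `|phi (b j) - g (b j)| < e) -> V g.
Proof.
move=> /(dual_ballP hK)[sphi phi1] /ptws_nbhs_box[s [d d0 sV]].
suff [m [e e0 h]] : exists m, exists2 e : K, 0 < e & forall g, @dual_ball K Z g ->
    (forall j, (j < m)%N -> `|phi (b j) - g (b j)| < e) ->
    forall u, u \in s -> `|phi u - g u| < d.
  by exists m, e => // g Bg /(h g Bg) /sV.
elim: s {sV} => [|u s [m [e e0 IH]]]; first by exists 0%N, 1.
have d4 : 0 < d / 4 by rewrite divr_gt0.
have [n [a ua]] := closed_spanP _ _ (valP u) _ d4.
pose v := \sum_(0 <= i < n) a i *: b i.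
have uv : `|u - v| < d / 4 by rewrite subspace_normE raddfB /= val_basis_sum.
pose A := 1 + \sum_(0 <= i < n) `|a i|.
have A0 : 0 < A by rewrite (lt_le_trans ltr01)// lerDl sumr_ge0.
have e'0 : 0 < d / 2 / A by rewrite !divr_gt0.
have [e'' e''0 [e''e e''e']] : exists2 c, 0 < c & c <= e /\ c <= d / 2 / A.
  by have /orP[le|le] := ger_leVge (ltW e0) (ltW e'0); [exists e|exists (d / 2 / A)].
exists (maxn m n), e'' => // g Bg hg w; rewrite inE => /predU1P[->|ws]; last first.
  apply: IH ws => // j jm; apply: lt_le_trans e''e; apply: hg.
  by rewrite (leq_trans jm)// leq_maxl.
have [sg g1] := (dual_ballP hK g).1 Bg.
have -> : phi u - g u = (phi (u - v) - g (u - v)) + (phi v - g v).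
  by rewrite (scalarB _ _ sphi) (scalarB _ _ sg); ring.
have h1 : `|phi (u - v) - g (u - v)| <= `|u - v| + `|u - v|.
  by rewrite (le_trans (ler_normB _ _))// lerD.
have h2 : `|phi v - g v| <= d / 2.
  rewrite (scalar_sum _ _ _ sphi) (scalar_sum _ _ _ sg) -sumrB.
  rewrite (le_trans (ler_norm_sum _ _ _))//.
  have : \sum_(0 <= i < n) `|a i| * e'' <= d / 2.
    rewrite -mulr_suml (le_trans (y := A * e''))//.
      by apply: ler_wpM2r; [exact: ltW|rewrite /A lerDr].
    by rewrite -ler_pdivlMl// mulrC.
  apply: le_trans; rewrite !big_nat ler_sum// => i /andP[_ ilt].
  rewrite (scalarZ _ _ sphi) (scalarZ _ _ sg) -mulrBr normrM ler_wpM2l//.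
  by rewrite ltW// hg// (leq_trans ilt)// leq_maxr.
rewrite (le_lt_trans (ler_normD _ _))// (splitr d) ltr_leD// (le_lt_trans h1)//.
by rewrite [X in _ < X](_ : _ = d / 4 + d / 4) ?ltrD//; field.
Qed.

(** At a successor, the box around f was treated at a stage whose vector y_n, of
    norm at most 1, separates two elements of the level in that box. *)
Lemma level_restriction i z : (z <= alpha)%O ->
  restriction (Y := Y) @` level (grid_radius i) z `<=` levelY (grid_radius i / 6) z.
Proof.
elim/(well_founded_ind olt_wf): z => z IH za.
have [z0|[z' zz']|zl] := ord_cases z.
- by rewrite z0 !szlenk_iter0 => _ [f Bf <-]; exact: restriction_ball.
- have z'z : (z' < z)%O by rewrite zz' lt_osucc.
  have z'a := lt_le_trans z'z za.
  have IHz' := IH _ z'z (ltW z'a).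
  rewrite zz' !szlenk_iterS => _ [f fz <-].
  have lf : level (grid_radius i) z' f by exact: szlenk_derivative_sub fz.
  have Bf : dual_ball f by exact: szlenk_iter_sub lf.
  have dY : levelY (grid_radius i / 6) z' `<=` @dual K Z.
    by move=> g /szlenk_iter_sub[].
  apply/(szlenk_derivativeP _ _ dY); split; first by apply: IHz'; exists f.
  move=> V oV Vf.
  have [m [e e0 mV]] := ball_nbhs_basis (restriction_ball Y hK Bf)
    (open_nbhs_nbhs (conj oV Vf)).
  have [n [Cn en bf near]] := request_box y f i m e0 z'a.
  have [|g [k [[Cg bg] [Ck bk] gk]]] := stage_far (stages n).
    by exists f; split => //; rewrite Cn en.
  rewrite Cn in Cg Ck; rewrite en in gk.
  have inV h : level (grid_radius i) z' h -> box request_centres request_tol n y h ->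
      (V `&` levelY (grid_radius i / 6) z') (restriction (Y := Y) h).
    move=> lh bh; split; last by apply: IHz'; exists h.
    apply: mV => [|j jm]; last exact: near.
    by apply: restriction_ball => //; exact: szlenk_iter_sub lh.
  apply/(diam_gtP hK); first by move=> h [_ /dY].
  exists (restriction (Y := Y) g), (restriction (Y := Y) k), (b n).
  by split; [exact: inV|exact: inV|exact: (stage_ball (stages n))|].
- move=> _ [f fz <-]; rewrite szlenk_iter_lim// => w /= wz.
  apply: IH => //; first exact: le_trans (ltW wz) za.
  by exists f => //; exact: szlenk_iter_anti (ltW wz) _ fz.
Qed.

(** Take the last level met by the extensions of phi, and an element of that level
    that was listed at a stage because of a small box around such an extension. *)
Lemma finite_coordinates_dense (phi : Z -> K) : dual_ball phi -> forall e : K, 0 < e ->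
  exists f n, [/\ dual f, forall m, (n <= m)%N -> f (y m) = 0 &
    forall u : Z, `|u| <= 1 -> `|phi u - f (\val u)| <= e].
Proof.
move=> Bphi e e0; have [i /andP[_ ie]] := grid_radius_near e0.
have [f0 Bf0 f0phi] := hahn_banach_extension hK Bphi.
have PB : @dual_ball K X `&` restriction (Y := Y) @^-1` [set phi] `<=` @dual_ball K X.
  by move=> f [].
have P0 : @dual_ball K X `&` restriction (Y := Y) @^-1` [set phi] !=set0 by exists f0.
have [z [za [f [[Bf fphi] fz]] Pz]] := szlenk_last_level hK (@fibre_compact _ _ Y hK phi)
  PB P0 (level_alpha (grid_radius_gt0 i)).
pose A := [set g | level (grid_radius i) z g /\
  exists2 u : Z, `|u| <= 1 & grid_radius i < `|phi u - restriction g u|].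
have [clA|nclA] := pselect (closure (restriction (Y := Y) @` A : set {ptws Z -> K}) phi).
  have AC : A `<=` level (grid_radius i) z by move=> g [].
  have Afar g : A g -> exists2 u : Z, `|u| <= 1 & grid_radius i < `|phi u - restriction g u|.
    by case.
  have [g gz gphi] := closure_restriction_lift hK (@szlenk_iter_sub _ _ _ _ _)
    (@szlenk_iter_ball_closed _ _ hK _ _) AC Afar clA.
  suff : (@dual_ball K X `&` restriction (Y := Y) @^-1` [set phi] `&` level (grid_radius i) (osucc z)) g.
    by rewrite Pz.
  rewrite szlenk_iterS; split => //; split => //.
  exact: szlenk_iter_sub (szlenk_derivative_sub gz).
have : nbhs (phi : {ptws Z -> K}) (~` closure (restriction (Y := Y) @` A : set {ptws Z -> K})).
  apply: open_nbhs_nbhs; split => //; exact/closed_openC/closed_closure.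
move=> /(ball_nbhs_basis Bphi)[m [d d0 mV]].
have [n [Cn _ bf near]] := request_box y f i m d0 za.
have [|g gG [Cg bg]] := stage_dense (stages n).
  by exists f; split => //; rewrite Cn.
rewrite Cn in Cg; exists g, n; split.
- exact: (stage_all_dual (stages n)).
- by move=> k nk; exact: (stage_annihilator (stages k) nk).
- move=> u u1; rewrite real_leNgt ?normr_real ?gtr0_real//; apply/negP => far.
  have : (~` closure (restriction (Y := Y) @` A : set {ptws Z -> K})) (restriction g).
    apply: mV => [|j jm]; first by apply: restriction_ball => //; exact: szlenk_iter_sub Cg.
    by rewrite -fphi; exact: near.
  apply; apply: subset_closure; exists g => //; split => //; exists u => //.
  exact: le_lt_trans far.
Qed.

Lemma ystar_biorthogonal i j : ystar i (y j) = (i == j)%:R.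
Proof.
have [ji|ij] := leqP j i; first exact: (stage_biorthogonal (stages i)).
by rewrite (ltn_eqF ij) (stage_ystar (stages j)).
Qed.

(** The tail of the longer sum lies in the kernel of [G n]. *)
Lemma stage_projection_bound n N a : (n <= N)%N ->
  `|\sum_(0 <= i < n) a i *: y i| <=
    (1 + delta) * `|\sum_(0 <= i < N) a i *: y i|.
Proof.
move=> nN; rewrite [in leRHS](big_cat_nat (n := n))//=.
apply: (stage_mazur (stages n)) => h hG.
have sh := dual_scalar (stage_all_dual (stages n) hG).
rewrite (scalar_sum _ _ _ sh) big_nat big1// => i /andP[ni _].
by rewrite (scalarZ _ _ sh) (stage_annihilator (stages i) ni)// mulr0.
Qed.

Lemma subspace_has_shrinking_basis : exists e : nat -> Z,
  [/\ schauder_basis e, shrinking e &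
    exists2 d, basis_constant e d & d <= 1 + delta].
Proof.
have dy i := stage_dual (stages i).
exists b; split.
- exact: (schauder_basis_vector dy ystar_biorthogonal delta_gt0 stage_projection_bound).
- apply: (shrinking_of_dense_coordinates hK dy ystar_biorthogonal delta_gt0 stage_projection_bound).
  exact: finite_coordinates_dense.
- exact: (basis_constant_vector hK dy ystar_biorthogonal delta_gt0 stage_projection_bound).
Qed.

Lemma levelY_alpha (eps : K) : 0 < eps -> levelY eps alpha = set0.
Proof.
move=> e0; have e2 : 0 < eps / 2 by rewrite divr_gt0.
rewrite -subset0 => phi; have -> : eps = (eps / 2) *+ 2 by rewrite mulr2n -splitr.
by move=> /(szlenk_iter_restriction hK e2)[f]; rewrite level_alpha.
Qed.

Lemma szlenk_eps_comparison (eps : K) xi zeta : 0 < eps ->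
  szlenk_eps_index X eps xi -> szlenk_eps_index Z (eps / 66) zeta ->
  (xi <= zeta)%O.
Proof.
move=> e0 [_ xi_min] [zeta0 _]; rewrite leNgt; apply/negP => zx.
have [i /andP[lo hi]] := grid_radius_near e0.
have xia : (xi <= alpha)%O by apply: xi_min; exact: level_alpha.
have : level eps zeta !=set0.
  by apply/set0P/eqP => /xi_min; rewrite leNgt zx.
move=> [f fz]; have fz' : level (grid_radius i) zeta f by exact: tree_derivative_le fz.
have : levelY (grid_radius i / 6) zeta (restriction f).
  apply: level_restriction; first exact: le_trans (ltW zx) xia.
  by exists f.
have le66 : eps / 66 <= grid_radius i / 6.
  by rewrite ler_pdivlMr// (le_trans _ lo)// le_eqVlt; apply/orP; left; apply/eqP; field.
by move/(tree_derivative_le le66); rewrite -[tree_derivative _ _ _]/(levelY _ _) zeta0.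
Qed.

End reduction.

Theorem theorem1 (R : realType) (K : numFieldType) (hK : scalar_field R K)
    (X : completeNormedModType K) (hX : infinite_dimensional X)
    (alpha : ord) (hSz : szlenk_index X alpha) (halpha : (alpha < omega1)%O)
    (delta : K) (hdelta : 0 < delta) :
  exists Y : submodClosed X,
    [/\ closed [set x | x \in Y],
        exists e : nat -> subspace_type Y,
          [/\ schauder_basis e, shrinking e &
              exists2 b, basis_constant e b & b <= 1 + delta],
        forall eps : K, 0 < eps -> exists xi zeta : ord,
          [/\ szlenk_eps_index X eps xi,
              szlenk_eps_index (subspace_type Y) (eps / 66) zeta &
              (xi <= zeta)%O] &
        szlenk_index (subspace_type Y) alpha].
Proof.
have K_ok := scalar_field_complete hK.
have [hdef [alpha_ub alpha_least]] := hSz.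
have level_alpha (eps : K) : 0 < eps -> szlenk_iter eps (@dual_ball K X) alpha = set0.
  move=> e0; have [xi hxi] := hdef _ e0; have [xi0 _] := hxi.
  rewrite -subset0 -xi0; apply: szlenk_iter_anti; apply: alpha_ub.
  by exists eps.
have [lv lv_onto] := countable_ord_enum halpha.
have [q q_dense] := scalars_separable K_ok.
have [y [ystar [G stages]]] := @stages_exist K X K_ok hX delta (request_set lv q)
  (request_eps q) (request_centres q) (@request_tol K) hdelta
  (fun n => @szlenk_iter_sub _ _ _ _ _) (fun n => grid_radius_gt0 q _).
have levelY0 (eps : K) : 0 < eps ->
    szlenk_iter eps (@dual_ball K (subspace_type (span_subspace y))) alpha = set0.
  exact: levelY_alpha.
have index_Y (eps : K) : 0 < eps -> exists zeta,
    szlenk_eps_index (subspace_type (span_subspace y)) eps zeta.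
  (* The index is defined because the levels of Y vanish at alpha at the latest. *)
  move=> e0; have [|zeta h1 h2] := @ord_least [set z |
      szlenk_iter eps (@dual_ball K (subspace_type (span_subspace y))) z = set0].
    by exists alpha; exact: levelY0.
  by exists zeta.
have compare (eps : K) xi zeta : 0 < eps -> szlenk_eps_index X eps xi ->
    szlenk_eps_index (subspace_type (span_subspace y)) (eps / 66) zeta -> (xi <= zeta)%O.
  exact: (szlenk_eps_comparison K_ok level_alpha lv_onto q_dense stages).
exists (span_subspace y); split.
- exact: span_subspace_closed.
- exact: (subspace_has_shrinking_basis K_ok hdelta level_alpha lv_onto q_dense stages).
- move=> eps e0; have [xi hxi] := hdef _ e0.
  have e66 : 0 < eps / 66 by rewrite divr_gt0.
  have [zeta hzeta] := index_Y _ e66.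
  by exists xi, zeta; split => //; exact: compare hzeta.
- split; first exact: index_Y.
  split; first by move=> zeta [eps e0 [_]]; apply; exact: levelY0.
  move=> c c_ub; apply: alpha_least => xi [eps e0 hxi].
  have e66 : 0 < eps / 66 by rewrite divr_gt0.
  have [zeta hzeta] := index_Y _ e66.
  apply: le_trans (compare _ _ _ e0 hxi hzeta) _.
  by apply: c_ub; exists (eps / 66).
Qed.
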